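(* Let $\boldsymbol n=(n_1,n_2)$, $\boldsymbol m=(m_1,m_2)$ be vectors of nonnegative integers with $n_1+n_2=m_1+m_2$, and let $\boldsymbol\lambda=(\lambda_1,\lambda_2)$, $\boldsymbol z=(z_1,z_2)$ have distinct coordinates. Let $(V,\boldsymbol z)$, $V=\langle p_1(x)e^{\lambda_1x},p_2(x)e^{\lambda_2x}\rangle$, be a space of the $(\boldsymbol\lambda,\boldsymbol z,\boldsymbol n,\boldsymbol m)$-type and let $(U,\boldsymbol\lambda)$, $U=\langle q_1(u)e^{z_1u},q_2(u)e^{z_2u}\rangle$, be its special bispectral dual space, of the $(\boldsymbol z,\boldsymbol\lambda,\boldsymbol m,\boldsymbol n)$-type. Write $$p_2(x)=\sum_{i=0}^{n_2}c_i\frac{(x-z_1)^{n_2-i}}{(n_2-i)!}\frac{(x-z_2)^i}{i!},\quad p_1(x)=\sum_{i=0}^{n_1}d_i\frac{(x-z_1)^{n_1-i}}{(n_1-i)!}\frac{(x-z_2)^i}{i!},\quad q_2(u)=\sum_{i=0}^{m_2}e_i\frac{(u-\lambda_1)^{m_2-i}}{(m_2-i)!}\frac{(u-\lambda_2)^i}{i!},$$ and put $\alpha=\max(0,n_2-m_1)$, $\beta=\min(m_2,n_2)$. Then the Bethe vectors $$\sum_{i=\alpha}^{\beta}c_i\,\frac{E_{21}^{n_2-i}v_{m_1}}{(n_2-i)!}\otimes\frac{E_{21}^iv_{m_2}}{i!},\qquad \sum_{j=m_2-\beta}^{m_2-\alpha}d_j\,\frac{E_{21}^{n_1-j}v_{m_1}}{(n_1-j)!}\otimes\frac{E_{21}^jv_{m_2}}{j!},\qquad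 \sum_{i=\alpha}^{\beta}e_i\,\frac{E_{21}^{m_2-i}v_{n_1}}{(m_2-i)!}\otimes\frac{E_{21}^iv_{n_2}}{i!}$$ are identified, up to proportionality, by the Weyl isomorphism $\mathcal W$ (first and second vectors) and the duality isomorphism $\mathcal D$ (third and first vectors) given in the context. That is, the image of the first vector under $\mathcal W$ and the second vector are linearly dependent; the image of the third vector under $\mathcal D$ and the first vector are linearly dependent; and $\mathcal W\mathcal D$ of the third vector and the second vector are linearly dependent.
   Context: **Modules.** $E_{ij}$ are the standard generators of $\mathfrak{gl}_2$. $L_m$ is the irreducible $\mathfrak{gl}_2$-module with highest weight $(m,0)$ and highest weight vector $v_m$; it has basis $E_{21}^iv_m$, $0\le i\le m$. $(L_{m_1}\otimes L_{m_2})[n_1,n_2]$ denotes the weight subspace of weight $[n_1,n_2]$; it has basis $\frac{E_{21}^{n_2-i}v_{m_1}}{(n_2-i)!}\otimes\frac{E_{21}^iv_{m_2}}{i!}$, $\alpha\le i\le\beta$, and $(L_{n_1}\otimes L_{n_2})[m_1,m_2]$ has basis $\frac{E_{21}^{m_2-i}v_{n_1}}{(m_2-i)!}\otimes\frac{E_{21}^iv_{n_2}}{i!}$, $\alpha\le i\le\beta$. The duality isomorphism $\mathcal D:(L_{n_1}\otimes L_{n_2})[m_1,m_2]\to(L_{m_1}\otimes L_{m_2})[n_1,n_2]$ sends $\frac{E_{21}^{m_2-i}v_{n_1}}{(m_2-i)!}\otimes\frac{E_{21}^iv_{n_2}}{i!}$ to $\frac{E_{21}^{n_2-i}v_{m_1}}{(n_2-i)!}\otimes\frac{E_{21}^iv_{m_2}}{i!}$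 for $\alpha\le i\le\beta$. The Weyl isomorphism $\mathcal W:(L_{m_1}\otimes L_{m_2})[n_1,n_2]\to(L_{m_1}\otimes L_{m_2})[n_2,n_1]$ sends $\frac{E_{21}^{n_2-i}v_{m_1}}{(n_2-i)!}\otimes\frac{E_{21}^iv_{m_2}}{i!}$ to $\frac{E_{21}^{m_1-n_2+i}v_{m_1}}{(m_1-n_2+i)!}\otimes\frac{E_{21}^{m_2-i}v_{m_2}}{(m_2-i)!}$. **Special spaces ($N=M=2$).** The exponents at $z\in\mathbb C$ of a $2$-dimensional space $V$ of meromorphic functions are the integers $e_1<e_2$ that are the orders at $z$ of elements of $V$; $z$ is singular if $\{e_1,e_2\}\ne\{0,1\}$. A pair $(V,\boldsymbol z)$ is a space of the $(\boldsymbol\lambda,\boldsymbol z,\boldsymbol n,\boldsymbol m)$-type if $V=\langle p_1e^{\lambda_1x},p_2e^{\lambda_2x}\rangle$ with polynomials $p_i$ of degree $n_i$, all singular points of $V$ are among $z_1,z_2$, and the exponents of $V$ at $z_a$ are $\{0<1+m_a\}$, $a=1,2$. **Special bispectral dual.** Let $\mathrm{Wr}_V$ be the Wronskian of a basis of $V$ and $V^\star=\{f/\mathrm{Wr}_V:f\in V\}$. Then $U$ is the span of the functions $\int_{\gamma_a}e^{ux}f(x)(x-z_1)^{-1}(x-z_2)^{-1}dx$, $a=1,2$, $f\in V^\star$, with $\gamma_a$ a small counterclockwise circle around $z_a$; $(U,\boldsymbol\lambda)$ is a space of the $(\boldsymbol z,\boldsymbol\lambda,\boldsymbol m,\boldsymbol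 n)$-type, so $U=\langle q_1e^{z_1u},q_2e^{z_2u}\rangle$ with $\deg q_a=m_a$. *)

(* Defs.v *)
From mathcomp Require Import all_boot all_order all_algebra.
From mathcomp Require Import ring zify.
From mathcomp Require Import complex.
From mathcomp Require Import all_classical all_reals all_analysis.

Set Implicit Arguments.
Unset Strict Implicit.
Unset Printing Implicit Defensive.

Import Order.TTheory GRing.Theory Num.Theory.
Import numFieldNormedType.Exports.

Local Open Scope classical_set_scope.
Local Open Scope ring_scope.
Local Open Scope complex_scope.

Section Modules.
Variable F : numFieldType.

(* [L_m] is realised on column vectors, the coordinate basis being
   [E_21^i v_m], [0 <= i <= m]; a matrix acts by left multiplication. *)

Definition E11 (m : nat) : 'M[F]_m.+1 :=
  \matrix_(i, j) ((i == j)%:R * (m - j)%:R).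

Definition E22 (m : nat) : 'M[F]_m.+1 :=
  \matrix_(i, j) ((i == j)%:R * j%:R).

Definition E21 (m : nat) : 'M[F]_m.+1 :=
  \matrix_(i, j) (i == j.+1 :> nat)%:R.

Definition E12 (m : nat) : 'M[F]_m.+1 :=
  \matrix_(i, j) ((j == i.+1 :> nat)%:R * (j * (m - i))%:R).

Definition hwv (m : nat) : 'cV[F]_m.+1 := delta_mx 0 0.

(* [L_{m1} (x) L_{m2}] is the space of matrices, [x (x) y] being [x y^T]. *)
Definition tens (m1 m2 : nat) (x : 'cV[F]_m1.+1) (y : 'cV[F]_m2.+1) :
    'M[F]_(m1.+1, m2.+1) := x *m y^T.

Definition tens_act (m1 m2 : nat) (X : 'M[F]_m1.+1) (Y : 'M[F]_m2.+1)
    (T : 'M[F]_(m1.+1, m2.+1)) : 'M[F]_(m1.+1, m2.+1) :=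
  X *m T + T *m Y^T.

Definition in_weight_space (m1 m2 k l : nat) (T : 'M[F]_(m1.+1, m2.+1)) : Prop :=
  tens_act (E11 m1) (E11 m2) T = k%:R *: T /\
  tens_act (E22 m1) (E22 m2) T = l%:R *: T.

Definition divpow (m i : nat) : 'cV[F]_m.+1 :=
  i`!%:R^-1 *: (E21 m ^+ i *m hwv m).

Definition wvec (m1 m2 l i : nat) : 'M[F]_(m1.+1, m2.+1) :=
  tens (divpow m1 (l - i)) (divpow m2 i).

(* [alpha = max(0, n_2 - m_1)], by truncated subtraction. *)
Definition alpha (n m : nat * nat) : nat := (n.2 - m.1)%N.
Definition beta (n m : nat * nat) : nat := minn m.2 n.2.

Definition range_tuple (n m : nat * nat) (T : Type) (w : nat -> T) :
    (beta n m - alpha n m).+1.-tuple T :=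
  [tuple w (alpha n m + k)%N | k < (beta n m - alpha n m).+1].

(* The linear map sending the k-th vector of the free family [X] to the k-th
   vector of [Y] (on the span of [X]). *)
Definition basis_map (vT wT : vectType F) (d : nat)
    (X : d.-tuple vT) (Y : d.-tuple wT) (v : vT) : wT :=
  \sum_(k < d) coord X k v *: tnth Y k.

(* Meaningful on [(L_{n1} (x) L_{n2})[m1, m2]], with values in
   [(L_{m1} (x) L_{m2})[n1, n2]]. *)
Definition duality (n m : nat * nat) :
    'M[F]_(n.1.+1, n.2.+1) -> 'M[F]_(m.1.+1, m.2.+1) :=
  basis_map (range_tuple n m (wvec n.1 n.2 m.2))
            (range_tuple n m (wvec m.1 m.2 n.2)).

(* Meaningful on [(L_{m1} (x) L_{m2})[n1, n2]], with values in
   [(L_{m1} (x) L_{m2})[n2, n1]]. *)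
Definition weyl (n m : nat * nat) :
    'M[F]_(m.1.+1, m.2.+1) -> 'M[F]_(m.1.+1, m.2.+1) :=
  basis_map (range_tuple n m (wvec m.1 m.2 n.2))
            (range_tuple n m (fun i =>
               tens (divpow m.1 (m.1 + i - n.2)) (divpow m.2 (m.2 - i)))).

Arguments duality n m _ : clear implicits.
Arguments weyl n m _ : clear implicits.

Local Notation bracket A B := (A *m B - B *m A).

Lemma gl2_relations m :
  [/\ bracket (E12 m) (E21 m) = E11 m - E22 m, bracket (E11 m) (E22 m) = 0,
      bracket (E11 m) (E12 m) = E12 m, bracket (E11 m) (E21 m) = - E21 m &
      bracket (E22 m) (E12 m) = - E12 m /\ bracket (E22 m) (E21 m) = E21 m].
Proof.
have E11d : E11 m = diag_mx (\row_j (m - j)%:R).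
  by apply/matrixP => i j; rewrite !mxE mulr_natl; case: eqP => [->|].
have E22d : E22 m = diag_mx (\row_j j%:R).
  by apply/matrixP => i j; rewrite !mxE mulr_natl; case: eqP => [->|].
have dl d A i j : (diag_mx d *m A) i j = d 0 i * A i j :> F.
  by rewrite mul_diag_mx mxE.
have dr d A i j : (A *m diag_mx d) i j = A i j * d 0 j :> F.
  by rewrite mul_mx_diag mxE.
have sm (i : 'I_m.+1) : (m - i)%:R = m%:R - i%:R :> F.
  by rewrite natrB // -ltnS.
have diagP : diag_mx (\row_(j < m.+1) (m - j)%:R) *m diag_mx (\row_j j%:R) -
    diag_mx (\row_j j%:R) *m diag_mx (\row_j (m - j)%:R) = 0 :> 'M[F]_m.+1.
  by rewrite diag_mxC subrr.
have brE A B i j : bracket A B i j = (A *m B) i j - (B *m A) i j :> F.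
  by rewrite !mxE.
split; rewrite ?E11d ?E22d //.
- apply/matrixP => i j; rewrite !mxE.
  have -> : \sum_k E12 m i k * E21 m k j =
      (i == j)%:R * (i.+1 * (m - i))%:R.
    have [im|im] := ltnP i m.
      rewrite (bigD1 (Ordinal (im : i.+1 < m.+1)%N)) //= big1 ?addr0 => [|k ki].
        by rewrite !mxE /= eqxx mul1r eqSS mulrC.
      rewrite !mxE; case: eqP => [kE|]; last by rewrite !mul0r.
      by case/eqP: ki; apply: val_inj.
    rewrite big1 => [|k _].
      by have /eqP -> : (m - i == 0)%N; rewrite ?subn_eq0 // muln0 mulr0.
    rewrite !mxE; case: eqP => [kE|]; last by rewrite !mul0r.
    by have := ltn_ord k; rewrite kE ltnS ltnNge im.
  have -> : \sum_k E21 m i k * E12 m k j = (i == j)%:R * (i * (m - i.-1))%:R.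
    case: i => [[|i] im] /=.
      by rewrite mul0n mulr0 big1 // => k _; rewrite mxE /= mul0r.
    rewrite (bigD1 (Ordinal (ltnW im))) //= big1 ?addr0 => [|k ki].
      rewrite !mxE /= eqxx mul1r -val_eqE /= eq_sym.
      by case: eqP => [->|]; rewrite ?mul0r.
    rewrite !mxE /= eqSS; case: eqP => [kE|]; last by rewrite !mul0r.
    by case/eqP: ki; apply: val_inj.
  rewrite -mulrBr; case: eqP => [->|_]; last by rewrite mul0r !mulr0n subrr.
  rewrite mul1r !mulr1n sm !natrM sm.
  case: j => [[|j] jm] /=; first by rewrite !mul0r mul1r !subr0.
  have jm' : (j <= m)%N by exact: ltnW.
  by rewrite natrB // -!natr1; ring.
- apply/matrixP => i j; rewrite brE dl dr !mxE.
  by case: eqP => [jE|_] /=; [rewrite !sm jE -natr1|]; ring.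
- apply/matrixP => i j; rewrite brE dl dr !mxE.
  by case: eqP => [iE|_] /=; [rewrite !sm iE -natr1|]; ring.
split; apply/matrixP => i j; rewrite brE dl dr !mxE.
- by case: eqP => [jE|_] /=; [rewrite jE -natr1|]; ring.
- by case: eqP => [iE|_] /=; [rewrite iE -natr1|]; ring.
Qed.

Lemma E21X_hwv m i : E21 m ^+ i *m hwv m = \col_j (j == i :> nat)%:R.
Proof.
elim: i => [|i IHi]; first by apply/matrixP => j k; rewrite mul1mx !mxE !ord1 andbT.
rewrite exprS -mulmxE -mulmxA {}IHi; apply/matrixP => j k; rewrite !mxE.
case: (ltnP i m.+1) => im; last first.
  rewrite big1 => [|l _]; last first.
    by rewrite !mxE [_ == i]ltn_eqF ?mulr0 // (leq_trans (ltn_ord l)).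
  by rewrite ltn_eqF // (leq_trans (ltn_ord j)) // (leq_trans im).
rewrite (bigD1 (Ordinal im)) //= big1 => [|l lE].
  by rewrite !mxE eqxx mulr1 addr0.
by rewrite !mxE (_ : (l == i :> nat) = false) ?mulr0 //; apply/negbTE.
Qed.

Lemma hwv_weight m :
  [/\ E12 m *m hwv m = 0, E11 m *m hwv m = m%:R *: hwv m &
      E22 m *m hwv m = 0].
Proof.
have hD (A : 'M[F]_m.+1) i j : (A *m hwv m) i j = A i 0.
  rewrite mxE (bigD1 ord0) //= big1 => [|k k0]; rewrite !mxE ?(negbTE k0) ?mulr0 //.
  by rewrite !ord1 mulr1 addr0.
split; apply/matrixP => i j; rewrite hD !mxE /= ?mul0r ?mulr0 //.
by rewrite ord1 subn0 andbT mulrC.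
Qed.

Lemma E12_coord m (x : 'cV[F]_m.+1) (i : 'I_m.+1) (im : (i.+1 < m.+1)%N) :
  (E12 m *m x) i 0 = (i.+1 * (m - i))%:R * x (Ordinal im) 0.
Proof.
rewrite mxE (bigD1 (Ordinal im)) //= big1 ?addr0 => [|k ki].
  by rewrite mxE eqxx mul1r.
rewrite mxE; case: eqP => [kE|]; last by rewrite !mul0r.
by case/eqP: ki; apply: val_inj.
Qed.

Lemma L_irreducible m (W : {vspace 'cV[F]_m.+1}) :
  (forall x, x \in W -> E12 m *m x \in W) ->
  (forall x, x \in W -> E21 m *m x \in W) ->
  W = 0%VS \/ W = fullv.
Proof.
move=> W12 W21.
have key d x : x \in W -> x != 0 ->
    (forall i : 'I_m.+1, (d < i)%N -> x i 0 = 0) -> hwv m \in W.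
  elim: d x => [|d IHd] x xW x0 xd.
    have xE : x = x 0 0 *: hwv m.
      apply/matrixP => i j; rewrite !mxE !ord1 andbT.
      by case: (eqVneq i 0) => [->|i0]; rewrite ?mulr1 // mulr0 xd // lt0n.
    have x00 : x 0 0 != 0.
      by apply: contraNneq x0 => x00; rewrite xE x00 scale0r.
    by rewrite -[hwv m](scalerK x00) memvZ // -xE.
  have [dm|dm] := ltnP d.+1 m.+1; last first.
    by apply: (IHd x) => // i di; have := ltn_ord i; lia.
  have [xd0|xd0] := eqVneq (x (Ordinal dm) 0) 0.
    apply: (IHd x) => // i; rewrite leq_eqVlt => /orP[/eqP iE|/xd //].
    by rewrite -xd0; congr (x _ _); apply: val_inj.
  apply: (IHd (E12 m *m x)); first exact: W12.
    apply/eqP => /matrixP /(_ (Ordinal (ltnW dm)) 0).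
    rewrite E12_coord mxE /= => /eqP; rewrite mulf_eq0 pnatr_eq0 muln_eq0 /=.
    rewrite subn_eq0 leqNgt -ltnS dm /= => /eqP xE.
    by case/eqP: xd0; rewrite -xE; congr (x _ _); apply: val_inj.
  move=> i di; case: (ltnP i.+1 m.+1) => im; first by rewrite E12_coord xd ?mulr0.
  rewrite mxE big1 // => k _; rewrite mxE [_ == i.+1]ltn_eqF ?mul0r //.
  exact: leq_trans (ltn_ord k) im.
have [->|W0] := eqVneq W 0%VS; [by left | right].
have hW : hwv m \in W.
  apply: (key m (vpick W) (memv_pick W)); rewrite ?vpick0 // => i.
  by rewrite ltnNge -ltnS ltn_ord.
have eW i : E21 m ^+ i *m hwv m \in W.
  elim: i => [|i IHi]; first by rewrite mul1mx.
  by rewrite exprS -mulmxE -mulmxA W21.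
apply/eqP; rewrite eqEsubv subvf; apply/subvP => x _.
have -> : x = \sum_i x i 0 *: (E21 m ^+ i *m hwv m).
  apply/matrixP => i j; rewrite summxE (bigD1 i) //= big1 => [|k ki].
    by rewrite !ord1 E21X_hwv !mxE eqxx mulr1 addr0.
  by rewrite E21X_hwv !mxE -val_eqE /= in ki *; rewrite eq_sym (negbTE ki) mulr0.
by apply: memv_suml => i _; apply: memvZ.
Qed.

Lemma wvecE m1 m2 l i (a : 'I_m1.+1) (b : 'I_m2.+1) :
  wvec m1 m2 l i a b =
    ((l - i)`!%:R * i`!%:R)^-1 * ((a == l - i :> nat)%N && (b == i :> nat))%:R.
Proof.
rewrite /wvec /tens /divpow !E21X_hwv mxE big_ord1 !mxE invfM mulrACA.
by rewrite -natrM mulnb.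
Qed.

Lemma free_wvec m1 m2 l a d :
  (forall k, (k < d)%N -> [/\ a + k <= l, l - (a + k) <= m1 & a + k <= m2]%N) ->
  free [tuple wvec m1 m2 l (a + k) | k < d].
Proof.
move=> H; apply/freeP => s s0 k.
have [kl km1 km2] := H _ (ltn_ord k).
move: s0; under eq_bigr do rewrite -tnth_nth tnth_mktuple.
move=> /matrixP /(_ (inord (l - (a + k))) (inord (a + k))).
rewrite summxE (bigD1 k) //= big1 => [|j jk].
  rewrite mxE wvecE !inordK ?ltnS // !eqxx mulr1 [RHS]mxE addr0.
  move/eqP; rewrite mulf_eq0 invr_eq0 mulf_eq0 !pnatr_eq0.
  by rewrite !(gtn_eqF (fact_gt0 _)) !orbF => /eqP.
rewrite mxE wvecE !inordK ?ltnS // eqn_add2l.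
by rewrite [k == j :> nat](_ : _ = false) ?andbF ?mulr0 // eq_sym; apply/negbTE.
Qed.

Lemma range_bounds (n m : nat * nat) k :
  (n.1 + n.2 = m.1 + m.2)%N -> (k < (beta n m - alpha n m).+1)%N ->
  [/\ alpha n m + k <= n.2, n.2 - (alpha n m + k) <= m.1,
      alpha n m + k <= m.2, alpha n m + k <= m.2 &
      m.2 - (alpha n m + k) <= n.1]%N.
Proof.
case: n m => [n1 n2] [m1 m2]; rewrite /alpha /beta /=.
by move=> nm kb; split; lia.
Qed.

Lemma free_weight_basis (n m : nat * nat) : (n.1 + n.2 = m.1 + m.2)%N ->
  free (range_tuple n m (wvec m.1 m.2 n.2)).
Proof. by move=> nm; apply: free_wvec => k /(range_bounds nm)[]. Qed.

Lemma free_weight_basis_dual (n m : nat * nat) : (n.1 + n.2 = m.1 + m.2)%N ->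
  free (range_tuple n m (wvec n.1 n.2 m.2)).
Proof. by move=> nm; apply: free_wvec => k /(range_bounds nm)[]. Qed.

Lemma tens_act_E11 m1 m2 (T : 'M[F]_(m1.+1, m2.+1)) a b :
  tens_act (E11 m1) (E11 m2) T a b = ((m1 - a) + (m2 - b))%:R * T a b.
Proof.
rewrite natrD mulrDl !mxE (bigD1 a) //= big1 => [|k ka]; last first.
  by rewrite mxE eq_sym (negbTE ka) !mul0r.
rewrite (bigD1 b) //= big1 => [|k kb]; last first.
  by rewrite !mxE eq_sym (negbTE kb) mul0r mulr0.
by rewrite !mxE !eqxx !mul1r !addr0 [X in _ + X]mulrC.
Qed.

Lemma tens_act_E22 m1 m2 (T : 'M[F]_(m1.+1, m2.+1)) a b :
  tens_act (E22 m1) (E22 m2) T a b = (a + b)%:R * T a b.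
Proof.
rewrite natrD mulrDl !mxE (bigD1 a) //= big1 => [|k ka]; last first.
  by rewrite mxE eq_sym (negbTE ka) !mul0r.
rewrite (bigD1 b) //= big1 => [|k kb]; last first.
  by rewrite !mxE eq_sym (negbTE kb) mul0r mulr0.
by rewrite !mxE !eqxx !mul1r !addr0 [X in _ + X]mulrC.
Qed.

Lemma weight_spaceP (n m : nat * nat) (T : 'M[F]_(m.1.+1, m.2.+1)) :
  (n.1 + n.2 = m.1 + m.2)%N ->
  in_weight_space n.1 n.2 T <->
  T \in <<range_tuple n m (wvec m.1 m.2 n.2)>>%VS.
Proof.
move=> nm.
have wP : in_weight_space n.1 n.2 T <->
    forall (a : 'I_m.1.+1) (b : 'I_m.2.+1), (a + b != n.2)%N -> T a b = 0.
  split=> [[_ /matrixP TE] a b ab|H].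
    have /eqP := TE a b; rewrite tens_act_E22 mxE -subr_eq0 -mulrBl mulf_eq0.
    by rewrite subr_eq0 eqr_nat (negbTE ab) => /eqP.
  split; apply/matrixP => a b; rewrite ?tens_act_E11 ?tens_act_E22 mxE.
    have [ab|/H ->] := eqVneq (a + b)%N n.2; last by rewrite !mulr0.
    congr (_%:R * _); have := ltn_ord a; have := ltn_ord b; rewrite !ltnS.
    by move: (a : nat) (b : nat) ab nm => a' b'; lia.
  by have [->|/H ->] := eqVneq (a + b)%N n.2; rewrite ?mulr0.
split=> [/wP H | Tspan].
  rewrite (matrix_sum_delta T); apply: memv_suml => a _; apply: memv_suml => b _.
  have [ab|/H ->] := eqVneq (a + b)%N n.2; last by rewrite scale0r mem0v.
  apply: memvZ.
  have -> : delta_mx a b =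
      ((n.2 - b)`!%:R * b`!%:R) *: wvec m.1 m.2 n.2 b :> 'M[F]_(_, _).
    apply/matrixP => i j; rewrite mxE [in RHS]mxE wvecE -ab addnK.
    by rewrite mulrA mulfV ?mul1r // mulf_eq0 !pnatr_eq0 !(gtn_eqF (fact_gt0 _)).
  apply/memvZ/memv_span; have := ltn_ord a; have := ltn_ord b; rewrite !ltnS.
  move=> bm am.
  have kP : (b - alpha n m < (beta n m - alpha n m).+1)%N.
    rewrite ltnS leq_sub2r // leq_min bm -ab leq_addl //.
  apply/tnthP; exists (Ordinal kP); rewrite tnth_mktuple /= subnKC //.
  by rewrite /alpha -ab leq_subLR leq_add2r.
apply/wP => a b ab; rewrite (coord_span Tspan) summxE big1 // => k _.
have [kn _ _ _ _] := range_bounds nm (ltn_ord k).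
rewrite mxE -tnth_nth tnth_mktuple wvecE.
case: eqP => [aE|]; last by rewrite !mulr0.
by case: eqP => [bE|]; rewrite ?mulr0 //; case/eqP: ab; rewrite aE bE subnK.
Qed.

Lemma basis_mapE (vT wT : vectType F) d (X : d.-tuple vT) (Y : d.-tuple wT) k :
  free X -> basis_map X Y (tnth X k) = tnth Y k.
Proof.
move=> fX; rewrite /basis_map (bigD1 k) //= big1 => [|j jk].
  by rewrite (tnth_nth 0) coord_free // eqxx scale1r addr0.
by rewrite (tnth_nth 0) coord_free // eq_sym (negbTE jk) scale0r.
Qed.

Lemma dualityE (n m : nat * nat) i : (n.1 + n.2 = m.1 + m.2)%N ->
  (alpha n m <= i <= beta n m)%N ->
  duality n m (wvec n.1 n.2 m.2 i) = wvec m.1 m.2 n.2 i.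
Proof.
move=> nm /andP[ai ib].
have kP : (i - alpha n m < (beta n m - alpha n m).+1)%N by rewrite ltnS leq_sub2r.
have := basis_mapE (range_tuple n m (wvec m.1 m.2 n.2)) (Ordinal kP)
  (free_weight_basis_dual nm).
by rewrite !tnth_mktuple /= subnKC.
Qed.

Lemma weylE (n m : nat * nat) i : (n.1 + n.2 = m.1 + m.2)%N ->
  (alpha n m <= i <= beta n m)%N ->
  weyl n m (wvec m.1 m.2 n.2 i) =
  tens (divpow m.1 (m.1 + i - n.2)) (divpow m.2 (m.2 - i)).
Proof.
move=> nm /andP[ai ib].
have kP : (i - alpha n m < (beta n m - alpha n m).+1)%N by rewrite ltnS leq_sub2r.
have := basis_mapE (range_tuple n m (fun i =>
  tens (divpow m.1 (m.1 + i - n.2)) (divpow m.2 (m.2 - i)))) (Ordinal kP)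
  (free_weight_basis nm).
by rewrite !tnth_mktuple /= subnKC.
Qed.

End Modules.

Arguments hwv {F} m.
Arguments divpow {F} m i.
Arguments wvec {F} m1 m2 l i.
Arguments duality {F} n m _.
Arguments weyl {F} n m _.

Section Spaces.
Variable R : realType.
Local Notation C := R[i].

Definition cexp (z : C) : C :=
  (expR (complex.Re z))%:C * (cos (complex.Im z) +i* sin (complex.Im z)).

(* [R[i]] receives its topology as a [numFieldType]. *)
Definition cderive (f : C -> C) : C -> C :=
  let K : numFieldType := C in derive1 (f : K -> K).

Definition ccvg (f : C -> C) (z l : C) : Prop :=
  let K : numFieldType := C in (f : K -> K) x @[x --> (z : K)^'] --> (l : K).

(* The order at [z] of a meromorphic function: [f(x) (x - z)^(-k)] has a
   finite nonzero limit at [z]. *)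
Definition has_order (f : C -> C) (z : C) (k : int) : Prop :=
  exists2 l : C, l != 0 & ccvg (fun x => f x / (x - z) ^ k) z l.

Definition cspan (S : set (C -> C)) : set (C -> C) :=
  [set f | exists (d : nat) (a : 'I_d -> C) (g : 'I_d -> C -> C),
     (forall k, S (g k)) /\ f = fun x => \sum_(k < d) a k * g k x].

Definition is_basis2 (V : set (C -> C)) (f g : C -> C) : Prop :=
  V = cspan [set f; g] /\
  forall a b : C, (forall x, a * f x + b * g x = 0) -> a = 0 /\ b = 0.

Definition exponents (V : set (C -> C)) (z : C) : set int :=
  [set k | exists2 f, V f & has_order f z k].

Definition singular (V : set (C -> C)) (z : C) : Prop :=
  exponents V z <> [set 0%:Z; 1%:Z].

Definition quasi_exp (p : {poly C}) (l : C) : C -> C :=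
  fun x => p.[x] * cexp (l * x).

Definition quasi_exp_space (lam : C * C) (n : nat * nat) (p1 p2 : {poly C})
    (V : set (C -> C)) : Prop :=
  [/\ size p1 = n.1.+1, size p2 = n.2.+1 &
      V = cspan [set quasi_exp p1 lam.1; quasi_exp p2 lam.2]].

Definition space_of_type (lam z : C * C) (n m : nat * nat)
    (V : set (C -> C)) : Prop :=
  [/\ exists p1 p2, quasi_exp_space lam n p1 p2 V,
      forall x, singular V x -> x = z.1 \/ x = z.2,
      exponents V z.1 = [set 0%:Z; (1 + m.1)%N%:Z] &
      exponents V z.2 = [set 0%:Z; (1 + m.2)%N%:Z]].

Definition wronskian (f g : C -> C) : C -> C :=
  fun x => f x * cderive g x - cderive f x * g x.

Definition star_space (V : set (C -> C)) : set (C -> C) :=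
  [set h | exists f1 f2 f, [/\ is_basis2 V f1 f2, V f &
     h = fun x => f x / wronskian f1 f2 x]].

Definition circle_integral (z : C) (r : R) (f : C -> C) : C :=
  let g (t : R) : C :=
    f (z + r%:C * cexp (0 +i* t)) * ((0 +i* r) * cexp (0 +i* t)) in
  (\int[lebesgue_measure]_(t in `[0, 2 * pi]) complex.Re (g t))%R +i*
  (\int[lebesgue_measure]_(t in `[0, 2 * pi]) complex.Im (g t))%R.

Definition bispectral_dual (z : C * C) (V : set (C -> C)) : set (C -> C) :=
  cspan [set g | exists (za : C) (f : C -> C),
    [/\ za = z.1 \/ za = z.2, star_space V f &
        \forall r \near (0 : R)^'+, forall u : C,
          g u = circle_integral za r
                  (fun x => cexp (u * x) * f x * (x - z.1)^-1 * (x - z.2)^-1)]].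

Definition two_point_poly (n : nat) (a b : C) (c : nat -> C) : {poly C} :=
  \sum_(i < n.+1) c i *:
    (((n - i)`!%:R^-1 *: ('X - a%:P) ^+ (n - i)) *
     (i`!%:R^-1 *: ('X - b%:P) ^+ i)).

End Spaces.

(* Main.v *)
Require Import Defs.
From mathcomp Require Import all_boot all_order all_algebra.
From mathcomp Require Import ring zify.
From mathcomp Require Import complex.
From mathcomp Require Import all_classical all_reals all_analysis.
Set Implicit Arguments.
Unset Strict Implicit.
Unset Printing Implicit Defensive.
Import Order.TTheory GRing.Theory Num.Theory.
Import numFieldNormedType.Exports.
Local Open Scope classical_set_scope.
Local Open Scope ring_scope.
Local Open Scope complex_scope.

(** The three coefficient families [c], [d], [e] are eigenvectors, with the same
    eigenvalue, of one and the same tridiagonal matrix.  On the indices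
    [alpha .. beta] that matrix has no zero entry just above the diagonal, and the
    entries that would couple this block to its complement vanish.  So an eigenvector is
    determined by its first coordinate, and the three families, the second one
    read backwards, are proportional.

    The matrix comes from differential equations.  The exponents [0 < 1 + m_a]
    at [z_a] make the Wronskian of [V] divisible by [(x - z_a)^{m_a}]; as its
    polynomial part has degree [n_1 + n_2 = m_1 + m_2], it is a constant times
    [(x - z_1)^{m_1} (x - z_2)^{m_2}].  The same argument bounds the poles of the
    last coefficient, and [V] is the solution space of
<<
      XY f'' - ((l_1 + l_2) XY + m_1 Y + m_2 X) f' + (l_1 l_2 XY + a X + b Y) f = 0,
      X = x - z_1,  Y = x - z_2,
>>
    with [a + b] prescribed by the degrees, so that one accessory parameter
    remains ([space_ode]).  Put [f = p_i e^{l_i x}] and expand [p_i] in the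
    monomials [X^{n-i} Y^i].  The terms of the equation are homogeneous of degree
    [n] or [n + 1] in [X] and [Y]; by Euler's identity the part of degree [n + 1]
    is divisible by [X - Y], which is constant, and what remains is a
    three-term recurrence ([tw_ode_tridiag]).  Reversing the index exchanges the
    recurrences of [p_1] and [p_2] ([tridiag_reverse]).

    The dual space [U] has an equation of the same shape, with [z] and [lambda],
    and [m] and [n], exchanged.  Its recurrence has the same off-diagonal
    entries, and it remains to compare the accessory parameters
    ([tridiag_dual], [dual_eigenvalue]).  For that, it suffices to have one nonzero
    function of [U] of the form [g(u) = \oint e^{ux} phi(x) dx].  The function
    [phi] satisfies the formal adjoint of the equation above; integration by parts
    on the closed contour turns [x] into [d/du] and
    shows that [g] satisfies a second order equation that differs from the
    equation of [U] by a constant in the coefficient of [g] only.  As [g] is not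
    zero, that constant vanishes.

    No residue is computed.  A nonzero [g] exists because [U] contains
    [q_2 e^{z_2 u}], and only two facts about the contour integral are used:
    the integral of a derivative along a closed path is zero, and one
    may differentiate in [u] under the integral sign. *)

(** * Polynomials written in two shifted variables *)

Section TwoPoint.
Variable F : numFieldType.
Implicit Types (a b : F) (c : nat -> F) (n : nat).

Definition divpowX a i : {poly F} := i`!%:R^-1 *: ('X - a%:P) ^+ i.

(** Over [R[i]] this is [two_point_poly], by conversion. *)
Definition tpoly n a b c : {poly F} :=
  \sum_(i < n.+1) c i *: (divpowX a (n - i) * divpowX b i).

Lemma mulr_nat_polyE k (p : {poly F}) : k%:R * p = k%:R *: p.
Proof. by rewrite -mul_polyC polyC_natr. Qed.

Lemma divpowXS a i : ('X - a%:P) * divpowX a i = i.+1%:R *: divpowX a i.+1.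
Proof.
rewrite /divpowX -scalerAr -exprS scalerA factS natrM; congr (_ *: _).
by rewrite invfM mulrA divff ?mul1r // pnatr_eq0.
Qed.

Lemma deriv_divpowX0 a : (divpowX a 0)^`() = 0.
Proof. by rewrite /divpowX expr0 linearZ /= derivC scaler0. Qed.

Lemma deriv_divpowXS a i : (divpowX a i.+1)^`() = divpowX a i.
Proof.
rewrite /divpowX derivZ deriv_exp derivXsubC mul1r /= -[_ *+ i.+1]scaler_nat scalerA factS natrM.
by rewrite invfM mulrAC mulVf ?mul1r // pnatr_eq0.
Qed.

Lemma eq_tpoly n a b c c' : (forall i, (i <= n)%N -> c i = c' i) ->
  tpoly n a b c = tpoly n a b c'.
Proof. by move=> E; apply: eq_bigr => i _; rewrite E // -ltnS. Qed.

Lemma tpolyZ n a b k c : k *: tpoly n a b c = tpoly n a b (fun i => k * c i).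
Proof. by rewrite scaler_sumr; apply: eq_bigr => i _; rewrite scalerA. Qed.

Lemma tpolyB n a b c c' : tpoly n a b c - tpoly n a b c' = tpoly n a b (fun i => c i - c' i).
Proof. by rewrite -sumrB; apply: eq_bigr => i _; rewrite scalerBl. Qed.

Lemma tpolyXl n a b c : ('X - a%:P) * tpoly n a b c =
  tpoly n.+1 a b (fun j => (n.+1 - j)%:R * c j).
Proof.
rewrite /tpoly [RHS]big_ord_recr /= subnn mul0r scale0r addr0 mulr_sumr.
apply: eq_bigr => i _; rewrite -scalerAr mulrA divpowXS -subSn; last by rewrite -ltnS.
by rewrite -scalerAl scalerA mulrC.
Qed.

Lemma tpolyXr n a b c : ('X - b%:P) * tpoly n a b c =
  tpoly n.+1 a b (fun j => j%:R * c j.-1).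
Proof.
rewrite /tpoly [RHS]big_ord_recl /= mul0r scale0r add0r mulr_sumr.
apply: eq_bigr => i _; rewrite -scalerAr mulrCA divpowXS /bump /= add1n subSS.
by rewrite -scalerAr scalerA mulrC.
Qed.

Lemma deriv_tpoly0 a b c : (tpoly 0 a b c)^`() = 0.
Proof.
by rewrite /tpoly big_ord1 linearZ /= derivM !deriv_divpowX0 mul0r mulr0 addr0 scaler0.
Qed.

Lemma deriv_tpolyS n a b c : (tpoly n.+1 a b c)^`() = tpoly n a b (fun j => c j + c j.+1).
Proof.
rewrite /tpoly linear_sum /=.
under eq_bigr do rewrite linearZ /= derivM scalerDr.
under [RHS]eq_bigr do rewrite scalerDl.
rewrite !big_split /=; congr (_ + _).
  rewrite big_ord_recr /= subnn deriv_divpowX0 mul0r scaler0 addr0.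
  by apply: eq_bigr => i _; rewrite subSn ?deriv_divpowXS // -ltnS.
rewrite big_ord_recl /= deriv_divpowX0 mulr0 scaler0 add0r.
by apply: eq_bigr => i _; rewrite /bump /= add1n deriv_divpowXS subSS.
Qed.

(** At [a] only the term without the factor [X - a] survives, so the last
    coefficient is zero; then [X - a] can be divided out. *)
Lemma tpoly_eq0 n a b c : a != b -> tpoly n a b c = 0 ->
  forall i, (i <= n)%N -> c i = 0.
Proof.
move=> ab; elim: n c => [|n IHn] c T0 i.
  rewrite leqn0 => /eqP ->; move: T0; rewrite /tpoly big_ord1 /divpowX !expr0.
  by rewrite fact0 invr1 scale1r mulr1 => /eqP; rewrite scaler_eq0 oner_eq0 orbF => /eqP.
have cn : c n.+1 = 0.
  have := congr1 (horner^~ a) T0; rewrite /tpoly big_ord_recr /= hornerD horner_sum.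
  rewrite big1 => [|j _]; last first.
    have jn : (j <= n)%N by rewrite -ltnS.
    by rewrite subSn // !hornerZ hornerM hornerZ horner_exp hornerXsubC subrr expr0n /= mulr0 mul0r mulr0.
  rewrite add0r subnn hornerZ hornerM !hornerZ !horner_exp !hornerXsubC horner0 expr0.
  move/eqP; rewrite !mulf_eq0 !invr_eq0 !pnatr_eq0 !(gtn_eqF (fact_gt0 _)).
  by rewrite expf_eq0 subr_eq0 (negbTE ab) ?oner_eq0 ?andbF /= ?orbF => /eqP.
have H : ('X - a%:P) * tpoly n a b (fun j => c j / (n.+1 - j)%:R) = 0.
  rewrite tpolyXl -[RHS]T0; apply: eq_tpoly => j; rewrite leq_eqVlt => /orP[/eqP ->|jn].
    by rewrite subnn mul0r cn.
  by rewrite mulrC divfK // pnatr_eq0 subn_eq0 -ltnNge.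
move: H => /eqP; rewrite mulf_eq0 polyXsubC_eq0 /= => /eqP /IHn H.
rewrite leq_eqVlt => /orP[/eqP -> //|]; rewrite ltnS => jn.
move: (H i jn) => /eqP; rewrite mulf_eq0 invr_eq0 pnatr_eq0 subn_eq0.
by rewrite leqNgt ltnS jn orbF => /eqP.
Qed.

Lemma size_divpowX a i : (size (divpowX a i) <= i.+1)%N.
Proof. by rewrite (leq_trans (size_scale_leq _ _)) // size_exp_XsubC. Qed.

Lemma size_tpoly n a b c : (size (tpoly n a b c) <= n.+1)%N.
Proof.
apply: (leq_trans (size_sum _ _ _)); apply/bigmax_leqP => i _.
rewrite (leq_trans (size_scale_leq _ _)) //.
rewrite (leq_trans (size_polyMleq _ _)) //.
have := size_divpowX a (n - i); have := size_divpowX b i; have := ltn_ord i.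
lia.
Qed.

(** The derivative has degree [n - 1] in the shifted variables, and [X - a] brings it
    back to [n].  For [n = 0] the truncated factor [n - j] is [0], as it should be. *)
Lemma tpoly_mulXl_deriv n a b c : ('X - a%:P) * (tpoly n a b c)^`() =
  tpoly n a b (fun j => (n - j)%:R * (c j + c j.+1)).
Proof.
case: n => [|n]; last by rewrite deriv_tpolyS tpolyXl.
rewrite deriv_tpoly0 mulr0 /tpoly big1 // => i _.
by rewrite sub0n mul0r scale0r.
Qed.

Lemma tpoly_mulXr_deriv n a b c : ('X - b%:P) * (tpoly n a b c)^`() =
  tpoly n a b (fun j => j%:R * (c j.-1 + c j)).
Proof.
case: n => [|n].
  rewrite deriv_tpoly0 mulr0 /tpoly big1 // => i _.
  by rewrite (ord1 i) /= ?mul0n mul0r scale0r.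
by rewrite deriv_tpolyS tpolyXr; apply: eq_tpoly => [[|j]] _; rewrite ?mul0r.
Qed.

Lemma tpoly_mulX2_deriv2 n a b c :
  ('X - a%:P) * ('X - b%:P) * (tpoly n a b c)^`()^`() =
  tpoly n a b (fun j => (j * (n - j))%:R * (c j.-1 + 2%:R * c j + c j.+1)).
Proof.
case: n => [|n].
  rewrite deriv_tpoly0 linear0 mulr0 /tpoly big1 // => i _.
  by rewrite (ord1 i) /= ?mul0n mul0r scale0r.
rewrite deriv_tpolyS mulrAC tpoly_mulXl_deriv mulrC tpolyXr; apply: eq_tpoly => [[|j]] _.
  by rewrite !mul0r.
rewrite subSS /= natrM -mulrA; congr (_ * (_ * _)); ring.
Qed.

(** Homogenize with [X = x - a] and [Y = x - b].  Euler's identity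
    [n P = X P_X + Y P_Y] gives [XY (P_X + P_Y) - n X P = - X (X - Y) P_X], and
    [X - Y] is the constant [b - a]. *)
Lemma tpoly_euler n a b c : ('X - a%:P) * ('X - b%:P) * (tpoly n a b c)^`() =
  n%:R * (('X - a%:P) * tpoly n a b c) -
  (b - a) *: tpoly n a b (fun j => (n - j)%:R * c j).
Proof.
have -> : (b - a) *: tpoly n a b (fun j => (n - j)%:R * c j) =
   ('X - a%:P) * tpoly n a b (fun j => (n - j)%:R * c j)
   - ('X - b%:P) * tpoly n a b (fun j => (n - j)%:R * c j).
  by rewrite -mulrBl -mul_polyC polyCB; ring.
rewrite -mulrA tpoly_mulXr_deriv !tpolyXl tpolyXr mulr_nat_polyE.
rewrite tpolyZ !tpolyB.
apply: eq_tpoly => [[|j]] jn /=.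
  by rewrite !mul0r !mulr0 !subn0; ring.
have E : (n.+1 - j.+1)%:R = n%:R - j%:R :> F by rewrite subSS natrB.
rewrite E; case: (leqP j.+1 n) => jn'; last first.
  have -> : j = n by lia.
  by rewrite subrr; ring.
by rewrite natrB // -natr1; ring.
Qed.

(** Row [j] of the tridiagonal matrix applied to [c].  At [j = 0] the value
    [c j.-1 = c 0] does no harm, its factor being [0]. *)
Definition tridiag (n : nat) (m : nat * nat) (h : F) (c : nat -> F) (j : nat) : F :=
  j%:R * ((n - j)%:R - m.1%:R) * c j.-1
  + (n - j)%:R * (j%:R - m.2%:R) * c j.+1
  + (2%:R * (n - j)%:R * j%:R - m.1%:R * j%:R - m.2%:R * (n - j)%:R - h * (n - j)%:R) * c j.

(** [e^{- l x} (e^{l x} p)']. *)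
Definition twD (l : F) (p : {poly F}) : {poly F} := p^`() + l *: p.

(** The second order equation of a space of the given type, written for
    [f = p e^{l0 x}] and divided by the exponential. *)
Definition tw_ode (l : F * F) (z : F * F) (m : nat * nat) (a b : F) (l0 : F) p :=
  let X := 'X - z.1%:P in let Y := 'X - z.2%:P in
  X * Y * twD l0 (twD l0 p)
  - ((l.1 + l.2) *: (X * Y) + m.1%:R * Y + m.2%:R * X) * twD l0 p
  + ((l.1 * l.2) *: (X * Y) + a *: X + b *: Y) * p = 0.

(** The equation has degree [n + 1] in the two shifted variables.  Its top
    coefficient, [k] in the proof, must vanish, which gives [a + b]; by
    [tpoly_euler] the rest has degree [n] and can be read off coefficientwise. *)
Lemma tw_ode_tridiag l z m a b n c : z.1 != z.2 ->
  size (tpoly n z.1 z.2 c) = n.+1 ->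
  tw_ode l z m a b l.2 (tpoly n z.1 z.2 c) ->
  a + b = l.2 * (m.1 + m.2)%:R - (l.2 - l.1) * n%:R /\
  forall j, (j <= n)%N ->
    tridiag n m ((z.2 - z.1) * (l.2 - l.1)) c j
    = (z.2 - z.1) * (b - l.2 * m.1%:R) * c j.
Proof.
move=> z12 sz; rewrite /tw_ode; set X := 'X - z.1%:P; set Y := 'X - z.2%:P.
set p := tpoly n z.1 z.2 c => E.
pose k := a + b - (l.2 * (m.1 + m.2)%:R - (l.2 - l.1) * n%:R).
pose s j := tridiag n m ((z.2 - z.1) * (l.2 - l.1)) c j
    - (z.2 - z.1) * (b - l.2 * m.1%:R) * c j.
have XY : X - Y = (z.2 - z.1)%:P by rewrite /X /Y polyCB; ring.
have E2 : k *: (X * p) + tpoly n z.1 z.2 s = 0.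
  rewrite -[RHS]E /twD !(derivD, derivZ).
  have -> : tpoly n z.1 z.2 s = X * Y * p^`()^`() - m.1%:R * (Y * p^`())
     - m.2%:R * (X * p^`())
     - ((z.2 - z.1) * (l.2 - l.1)) *: tpoly n z.1 z.2 (fun j => (n - j)%:R * c j)
     - ((z.2 - z.1) * (b - l.2 * m.1%:R)) *: p.
    rewrite tpoly_mulX2_deriv2 tpoly_mulXl_deriv tpoly_mulXr_deriv !mulr_nat_polyE.
    rewrite !tpolyZ !tpolyB; apply: eq_tpoly => j jn.
    by rewrite /s /tridiag natrM; ring.
  have := tpoly_euler n z.1 z.2 c; rewrite -/X -/Y -/p => eu.
  have -> : ((z.2 - z.1) * (l.2 - l.1)) *: tpoly n z.1 z.2 (fun j => (n - j)%:R * c j)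
     = (l.2 - l.1)%:P * (n%:R * (X * p) - X * Y * p^`()).
    by rewrite eu subKr -!mul_polyC polyCM; ring.
  rewrite -!mul_polyC [(_ * (b - _))%:P]polyCM -XY /k !(polyCD, polyCB, polyCM, polyCN).
  rewrite !polyC_natr natrD; ring.
have k0 : k = 0.
  apply/eqP; apply/negP => /negP k0.
  have : k *: (X * p) = - tpoly n z.1 z.2 s by apply/eqP; rewrite -addr_eq0 E2.
  move/(congr1 (size \o polyseq)) => /=.
  rewrite size_scale // size_polyN size_mul ?polyXsubC_eq0 //; last first.
    by rewrite -size_poly_eq0 sz.
  rewrite size_XsubC sz /= => H; have := size_tpoly n z.1 z.2 s.
  by rewrite -H ltnn.
split; first by apply/eqP; rewrite -subr_eq0 -/k k0.
move=> j jn; apply/eqP; rewrite -subr_eq0; apply/eqP.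
by move: E2; rewrite k0 scale0r add0r => /(tpoly_eq0 z12) /(_ j jn).
Qed.

(** A linear combination of two eigenvectors that vanishes at [al] vanishes
    further on: row [i] gives the entry [i + 1] from the entries [i - 1] and [i].
    Row [al] does not see the entry [al - 1], since [al = 0] or [n - al = m.1]. *)
Lemma tridiag_eigen_unique n m h h0 (x y : nat -> F) (al be : nat) :
  (al <= be)%N -> (be <= n)%N -> (be <= m.2)%N ->
  (al = 0 \/ al + m.1 = n)%N ->
  (forall j, (al <= j <= be)%N -> tridiag n m h x j = h0 * x j) ->
  (forall j, (al <= j <= be)%N -> tridiag n m h y j = h0 * y j) ->
  exists s t : F, (s, t) != (0, 0) /\
    forall j, (al <= j <= be)%N -> s * x j + t * y j = 0.
Proof.
move=> ab bn bm al0 Hx Hy.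
have key s t : s * x al + t * y al = 0 ->
   forall k j, (al <= j <= al + k)%N -> (j <= be)%N -> s * x j + t * y j = 0.
  move=> H0; elim=> [|k IHk] j.
    by rewrite addn0 -eqn_leq => /eqP <-.
  move=> /andP[aj]; rewrite leq_eqVlt => /orP[/eqP jE|]; last first.
    by rewrite addnS ltnS => jk; apply: IHk; rewrite aj.
  move=> jb; set i := (al + k)%N; have ji : j = i.+1 by rewrite jE addnS.
  have ib : (al <= i <= be)%N by rewrite leq_addr -ltnS -ji ltnW.
  have Zi : s * x i + t * y i = 0 by apply: IHk; rewrite ?leqnn ?leq_addr //; case/andP: ib.
  have Z : i%:R * ((n - i)%:R - m.1%:R) * (s * x i.-1 + t * y i.-1) = 0.
    case: (ltnP al i) => ai.
      by rewrite (IHk i.-1) ?mulr0 //; move: ai ib; rewrite /i; lia.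
    have ia : i = al by apply/eqP; rewrite eqn_leq ai; case/andP: ib.
    case: al0 => al0; first by rewrite ia al0 !mul0r.
    have -> : (n - i)%N = m.1 by rewrite ia -al0 addKn.
    by rewrite subrr mulr0 mul0r.
  have : (n - i)%:R * (i%:R - m.2%:R) * (s * x i.+1 + t * y i.+1) = 0.
    have Sx := Hx _ ib; have Sy := Hy _ ib.
    have -> : (n - i)%:R * (i%:R - m.2%:R) * (s * x i.+1 + t * y i.+1) =
      s * tridiag n m h x i + t * tridiag n m h y i
      - i%:R * ((n - i)%:R - m.1%:R) * (s * x i.-1 + t * y i.-1)
      - (2%:R * (n - i)%:R * i%:R - m.1%:R * i%:R - m.2%:R * (n - i)%:R
          - h * (n - i)%:R) * (s * x i + t * y i).
      by rewrite /tridiag; ring.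
    rewrite Sx Sy Z Zi; have -> : s * (h0 * x i) + t * (h0 * y i) = h0 * (s * x i + t * y i) by ring.
    by rewrite Zi !mulr0 !subr0.
  move/eqP; rewrite mulf_eq0 => /orP[|/eqP <-]; last by rewrite ji.
  rewrite mulf_eq0 pnatr_eq0 subn_eq0 subr_eq0 eqr_nat.
  by move=> /orP[|/eqP] H; exfalso; move: H bn bm jb; rewrite ji; clear; lia.
have [H|H] := eqVneq (y al, x al) (0, 0).
  have [y0 x0] : y al = 0 /\ x al = 0 by case: H.
  exists 1, 1; split; first by rewrite xpair_eqE oner_eq0.
  move=> j /andP[aj jb]; apply: (@key 1 1 _ (j - al)%N) => //.
    by rewrite x0 y0 !mulr0 addr0.
  by rewrite subnKC // aj leqnn.
exists (y al), (- x al); split; first by move: H; rewrite !xpair_eqE oppr_eq0.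
move=> j /andP[aj jb]; apply: (@key _ _ _ (j - al)%N) => //.
  by rewrite mulNr mulrC subrr.
by rewrite subnKC // aj leqnn.
Qed.

End TwoPoint.

(** * The differential equation of a space with two finite singular points *)

Section Ode.
Variable F : numFieldType.
Implicit Types (p q : {poly F}).

(** [e^{- (l_1 + l_2) x}] times the Wronskian of [p1 e^{l_1 x}] and
    [p2 e^{l_2 x}]; [twWrD] is the same for the derivatives of these functions. *)
Definition twWr (l : F * F) p1 p2 : {poly F} := p1 * twD l.2 p2 - twD l.1 p1 * p2.
Definition twWrD (l : F * F) p1 p2 : {poly F} :=
  twD l.1 p1 * twD l.2 (twD l.2 p2) - twD l.1 (twD l.1 p1) * twD l.2 p2.

Lemma twDM l p q : twD l (p * q) = p^`() * q + p * twD l q.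
Proof. by rewrite /twD derivM -!mul_polyC; ring. Qed.

Lemma twDD l p q : twD l (p + q) = twD l p + twD l q.
Proof. by rewrite /twD derivD scalerDr; ring. Qed.

Lemma twDZ l k p : twD l (k *: p) = k *: twD l p.
Proof. by rewrite /twD derivZ scalerDr !scalerA mulrC. Qed.

Lemma dvdp_twD l z k p : ('X - z%:P) ^+ k.+1 %| p -> ('X - z%:P) ^+ k %| twD l p.
Proof.
move=> /dvdpP [r ->]; rewrite mulrC twDM deriv_exp derivXsubC mul1r /= -mulr_natl exprS.
by apply/dvdpP; exists (k.+1%:R * r + ('X - z%:P) * twD l r); ring.
Qed.

Lemma dvdp_mul_twD l z k p : ('X - z%:P) ^+ k %| p ->
  ('X - z%:P) ^+ k %| ('X - z%:P) * twD l p.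
Proof.
case: k => [|k]; first by move=> _; rewrite expr0 dvd1p.
by move/dvdp_twD => /(_ l) H; rewrite exprS dvdp_mul.
Qed.

(** [T] stands for a Taylor polynomial of [e^{(l_2 - l_1) x}] at [z], so that
    [P = A p1 + B p2 T] is a polynomial model of the function
    [A p1 e^{l_1 x} + B p2 e^{l_2 x}] divided by [e^{l_1 x}].  Replacing [A p1] by
    [P] in the determinants costs multiples of [P], [P'], [P''] and of the
    truncation error only; the term [P''] is the reason for the factor [X - z]
    in the second conclusion. *)
Lemma indicial (l : F * F) z k p1 p2 T S A B : A != 0 ->
  T^`() = (l.2 - l.1) *: T + ('X - z%:P) ^+ k.+1 * S ->
  ('X - z%:P) ^+ k.+1 %| A *: p1 + B *: (p2 * T) ->
  ('X - z%:P) ^+ k %| twWr l p1 p2 /\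
  ('X - z%:P) ^+ k %| ('X - z%:P) * twWrD l p1 p2.
Proof.
move=> A0 dT; set X := 'X - z%:P; set P := A *: p1 + _ => XP.
have tT : twD l.1 T = l.2 *: T + X ^+ k.+1 * S.
  by rewrite /twD dT -!mul_polyC polyCB; ring.
set E := B *: (p2 * (X ^+ k.+1 * S)).
have D1P : A *: twD l.1 p1 + B *: (twD l.2 p2 * T) = twD l.1 P - E.
  rewrite /P /E [twD _ (A *: _ + _)]twDD !twDZ [twD _ (_ * T)]twDM tT /twD -!mul_polyC; ring.
have D2P : A *: twD l.1 (twD l.1 p1) + B *: (twD l.2 (twD l.2 p2) * T) =
   twD l.1 (twD l.1 P) - twD l.1 E - B *: (twD l.2 p2 * (X ^+ k.+1 * S)).
  have -> : twD l.1 (twD l.1 P) = twD l.1 (A *: twD l.1 p1 + B *: (twD l.2 p2 * T)) + twD l.1 E.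
    by rewrite D1P -twDD subrK.
  rewrite addrK [twD _ (A *: _ + _)]twDD !twDZ [twD _ (_ * T)]twDM tT -!mul_polyC.
  by rewrite /twD -!mul_polyC; ring.
have XE : X ^+ k.+1 %| E by rewrite /E -mul_polyC dvdp_mull // dvdp_mull // dvdp_mulr.
set d1 := twD l.1 P - E in D1P.
have Xd1 : X ^+ k %| d1.
  by rewrite /d1 dvdp_sub ?dvdp_twD // (dvdp_trans _ XE) // exprS dvdp_mull.
have Xd2 : X ^+ k %| X * (twD l.1 (twD l.1 P) - twD l.1 E - B *: (twD l.2 p2 * (X ^+ k.+1 * S))).
  rewrite !mulrBr !dvdp_sub //.
  - by apply/dvdp_mul_twD/dvdp_twD.
  - by rewrite dvdp_mull // dvdp_twD.
  - by rewrite -mul_polyC 3?dvdp_mull // dvdp_mulr // exprS dvdp_mull.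
split.
  rewrite -(dvdpZr _ _ A0).
  have -> : A *: twWr l p1 p2 = P * twD l.2 p2 - d1 * p2.
    by rewrite -D1P /P /twWr -!mul_polyC; ring.
  by rewrite dvdp_sub ?dvdp_mulr // (dvdp_trans _ XP) // exprS dvdp_mull.
rewrite -(dvdpZr _ _ A0).
have -> : A *: (X * twWrD l p1 p2) = X * d1 * twD l.2 (twD l.2 p2) -
   (X * (twD l.1 (twD l.1 P) - twD l.1 E - B *: (twD l.2 p2 * (X ^+ k.+1 * S)))) * twD l.2 p2.
  by rewrite -D2P -D1P /twWrD -!mul_polyC; ring.
by rewrite dvdp_sub // dvdp_mulr // dvdp_mull.
Qed.

Lemma twWr_swap l p1 p2 : twWr (l.2, l.1) p2 p1 = - twWr l p1 p2.
Proof. by rewrite /twWr; ring. Qed.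
Lemma twWrD_swap l p1 p2 : twWrD (l.2, l.1) p2 p1 = - twWrD l p1 p2.
Proof. by rewrite /twWrD; ring. Qed.

Lemma size_deriv_le n p : (size p <= n.+1)%N -> (size p^`() <= n)%N.
Proof.
have [->|p0] := eqVneq p 0; first by rewrite deriv0 size_poly0.
by move=> H; rewrite -ltnS (leq_trans _ H) // lt_size_deriv.
Qed.

Lemma size_mul_le p q i j k : (size p <= i)%N -> (size q <= j)%N -> (i + j <= k.+1)%N ->
  (size (p * q)%R <= k)%N.
Proof.
move=> pi qj ijk; apply: leq_trans (size_polyMleq _ _) _.
by move: (size p) (size q) pi qj => u v; lia.
Qed.

(** Cramer's rule gives an equation for [p1 e^{l_1 x}] and [p2 e^{l_2 x}] with
    coefficients [W], [- (W' + (l_1 + l_2) W)] and [N].  Degrees force [W] to be a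
    multiple of [X^{m_1} Y^{m_2}]; then [XY W' = (m_1 Y + m_2 X) W], and [W] divides
    [XY N].  The quotient has top coefficient [l_1 l_2]: subtracting [l_1 l_2 W] from
    [N] lowers the degree, which leaves a linear remainder. *)
Lemma ode_of_indices (l z : F * F) (n m : nat * nat) p1 p2 :
  (n.1 + n.2 = m.1 + m.2)%N -> l.1 != l.2 -> z.1 != z.2 ->
  size p1 = n.1.+1 -> size p2 = n.2.+1 ->
  let X : {poly F} := 'X - z.1%:P in let Y : {poly F} := 'X - z.2%:P in
  X ^+ m.1 %| twWr l p1 p2 -> X ^+ m.1 %| X * twWrD l p1 p2 ->
  Y ^+ m.2 %| twWr l p1 p2 -> Y ^+ m.2 %| Y * twWrD l p1 p2 ->
  (exists C, twWr l p1 p2 = C *: (X ^+ m.1 * Y ^+ m.2)) /\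
  exists a b, tw_ode l z m a b l.1 p1 /\ tw_ode l z m a b l.2 p2.
Proof.
move=> nm l12 z12 s1 s2 X Y XW XN YW YN.
set W := twWr _ _ _ in XW YW *; set N := twWrD _ _ _ in XN YN *.
have XYc : coprimep (X ^+ m.1) (Y ^+ m.2).
  by rewrite coprimep_expl // coprimep_expr // coprimep_XsubC2 // subr_eq0 eq_sym.
have s1' := size_deriv_le (eq_leq s1); have s2' := size_deriv_le (eq_leq s2).
have s1'' : (size p1^`()^`() <= n.1)%N.
  by rewrite (size_deriv_le (leq_trans s1' _)).
have s2'' : (size p2^`()^`() <= n.2)%N.
  by rewrite (size_deriv_le (leq_trans s2' _)).
have sW : size W = (n.1 + n.2).+1.
  have -> : W = (l.2 - l.1) *: (p1 * p2) + (p1 * p2^`() - p1^`() * p2).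
    by rewrite /W /twWr /twD -!mul_polyC polyCB; ring.
  have sp : size ((l.2 - l.1) *: (p1 * p2)) = (n.1 + n.2).+1.
    rewrite size_scale ?subr_eq0 1?eq_sym // size_mul -?size_poly_eq0 ?s1 ?s2 //=.
    by rewrite addnS.
  rewrite size_polyDl sp // ltnS (leq_trans (size_polyD _ _)) // geq_max size_polyN.
  by rewrite (size_mul_le (eq_leq s1) s2') ?(size_mul_le s1' (eq_leq s2)) //; lia.
have XYW : X ^+ m.1 * Y ^+ m.2 %| W by rewrite Gauss_dvdp // XW.
have sXY : size (X ^+ m.1 * Y ^+ m.2) = (m.1 + m.2).+1.
  rewrite size_mul ?expf_neq0 ?polyXsubC_eq0 // !size_exp_XsubC /=.
  by rewrite addnS.
have W0 : W != 0 by rewrite -size_poly_gt0 sW.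
have : X ^+ m.1 * Y ^+ m.2 %= W.
  by rewrite -dvdp_size_eqp // sXY sW nm.
rewrite eqp_sym => /eqpfP; rewrite (_ : lead_coef (X ^+ m.1 * Y ^+ m.2) = 1); last first.
  by rewrite lead_coefM !lead_coef_exp !lead_coefXsubC !expr1n mulr1.
rewrite invr1 mulr1 => WE.
have C0 : lead_coef W != 0 by rewrite lead_coef_eq0.
split; first by exists (lead_coef W).
set C := lead_coef W in WE C0.
(* The top degree terms of N and of (l_1 l_2) W cancel. *)
set N' := N - (l.1 * l.2) *: W.
have sN' : (size N' <= n.1 + n.2)%N.
  have -> : N' = p1^`() * p2^`()^`() - p1^`()^`() * p2^`()
     + (2%:R * l.2 - 2%:R * l.1) *: (p1^`() * p2^`())
     + l.1 *: (p1 * p2^`()^`()) - l.2 *: (p1^`()^`() * p2)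
     + (l.2 ^+ 2 - l.1 * l.2) *: (p1^`() * p2)
     + (l.1 * l.2 - l.1 ^+ 2) *: (p1 * p2^`()).
    rewrite /N' /N /W /twWrD /twWr /twD !(derivD, derivZ) -!mul_polyC.
    by rewrite !(polyCB, polyCD, polyCM, polyC_exp, polyC_natr); ring.
  have szD (u v : {poly F}) k : (size u <= k)%N -> (size v <= k)%N -> (size (u + v)%R <= k)%N.
    by move=> uk vk; rewrite (leq_trans (size_polyD _ _)) // geq_max uk.
  have szZ e (u : {poly F}) k : (size u <= k)%N -> (size (e *: u)%R <= k)%N.
    exact: leq_trans (size_scale_leq _ _).
  have k0 : (n.1 + n.2 <= (n.1 + n.2).+1)%N := leqnSn _.
  have k1 : (n.1.+1 + n.2 <= (n.1 + n.2).+1)%N by rewrite addSn.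
  have k2 : (n.1 + n.2.+1 <= (n.1 + n.2).+1)%N by rewrite addnS.
  have t1 := eq_leq s1; have t2 := eq_leq s2.
  by rewrite !szD ?size_polyN ?szZ ?(size_mul_le s1' s2'' k0) ?(size_mul_le s1'' s2' k0)
    ?(size_mul_le s1' s2' k0) ?(size_mul_le t1 s2'' k1) ?(size_mul_le s1'' t2 k2)
    ?(size_mul_le s1' t2 k2) ?(size_mul_le t1 s2' k1).
have XYN : X ^+ m.1 * Y ^+ m.2 %| X * Y * N.
  rewrite Gauss_dvdp //; apply/andP; split.
    by rewrite -mulrA [Y * _]mulrC mulrA dvdp_mulr.
  by rewrite -mulrA dvdp_mull.
have : W %| X * Y * N'.
  rewrite {1}WE dvdpZl // /N' mulrBr dvdp_sub //.
  by rewrite dvdp_mull // -mul_polyC dvdp_mull.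
case/dvdpP => q qE.
have sq : (size q <= 2)%N.
  have [->|q0] := eqVneq q 0; first by rewrite size_poly0.
  have : (size (q * W)%R <= (n.1 + n.2).+2)%N.
    have sXY2 : (size (X * Y)%R <= 3)%N by rewrite size_mul ?polyXsubC_eq0 // !size_XsubC.
    by rewrite -qE (size_mul_le sXY2 sN') // add3n.
  by rewrite size_mul // sW addnS /= -add2n leq_add2r.
(* Lagrange interpolation of q, of degree at most 1, at z_1 and z_2. *)
pose a := q.[z.2] / (z.2 - z.1); pose b := q.[z.1] / (z.1 - z.2).
have q_ab : q = a *: X + b *: Y.
  apply/eqP; rewrite -subr_eq0; apply/eqP.
  apply: (@roots_geq_poly_eq0 _ _ [:: z.1; z.2]); last 1 first.
  - apply: leq_trans (size_polyD _ _) _; rewrite geq_max sq size_polyN.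
    apply: leq_trans (size_polyD _ _) _; rewrite geq_max.
    by rewrite !(leq_trans (size_scale_leq _ _)) // size_XsubC.
  - rewrite /= /root /X /Y !(hornerD, hornerN, hornerZ, hornerXsubC, hornerX, hornerC).
    rewrite !subrr !mulr0 add0r addr0 /a /b !divfK ?subr_eq0 // 1?eq_sym //.
    by rewrite !eqxx.
  - by rewrite /= inE z12.
have XYW' : X * Y * W^`() = (m.1%:R * Y + m.2%:R * X) * W.
  have XE z0 k : ('X - z0%:P) * (('X - z0%:P) ^+ k)^`() = k%:R * ('X - z0%:P) ^+ k :> {poly F}.
    case: k => [|k]; first by rewrite expr0 derivC mulr0 mul0r.
    by rewrite deriv_exp derivXsubC mul1r exprS -mulr_natl /=; ring.
  rewrite WE derivZ derivM -!mul_polyC.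
  transitivity (C%:P * ((X * (X ^+ m.1)^`()) * (Y * Y ^+ m.2) + (X * X ^+ m.1) * (Y * (Y ^+ m.2)^`()))).
    by ring.
  by rewrite !XE; ring.
have N_E : X * Y * N = W * ((l.1 * l.2) *: (X * Y) + a *: X + b *: Y).
  have -> : N = N' + (l.1 * l.2) *: W by rewrite subrK.
  by rewrite mulrDr qE q_ab -!mul_polyC; ring.
exists a, b; split; apply: (mulfI W0); rewrite mulr0 -/X -/Y.
  transitivity (X * Y * (W * twD l.1 (twD l.1 p1)
      - (W^`() + (l.1 + l.2) *: W) * twD l.1 p1 + N * p1)
     + (X * Y * W^`() - (m.1%:R * Y + m.2%:R * X) * W) * twD l.1 p1
     - (X * Y * N - W * ((l.1 * l.2) *: (X * Y) + a *: X + b *: Y)) * p1).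
    by rewrite -!mul_polyC; ring.
  rewrite XYW' N_E !subrr !mul0r subr0 addr0 /W /N /twWr /twWrD /twD.
  by rewrite !(derivD, derivN, derivM, derivZ) -!mul_polyC !polyCD; ring.
transitivity (X * Y * (W * twD l.2 (twD l.2 p2)
      - (W^`() + (l.1 + l.2) *: W) * twD l.2 p2 + N * p2)
     + (X * Y * W^`() - (m.1%:R * Y + m.2%:R * X) * W) * twD l.2 p2
     - (X * Y * N - W * ((l.1 * l.2) *: (X * Y) + a *: X + b *: Y)) * p2).
  by rewrite -!mul_polyC; ring.
rewrite XYW' N_E !subrr !mul0r subr0 addr0 /W /N /twWr /twWrD /twD.
by rewrite !(derivD, derivN, derivM, derivZ) -!mul_polyC !polyCD; ring.
Qed.
End Ode.

(** * Calculus along smooth paths in the complex plane *)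

Section Paths.
Variable R : realType.
Local Notation C := R[i].
Implicit Types (z w u v : C) (f g : R -> C).

Lemma cReM z w : complex.Re (z * w) = complex.Re z * complex.Re w - complex.Im z * complex.Im w.
Proof. by case: z w => [a b] [c d]. Qed.
Lemma cImM z w : complex.Im (z * w) = complex.Re z * complex.Im w + complex.Im z * complex.Re w.
Proof. by case: z w => [a b] [c d]. Qed.
Lemma cReD z w : complex.Re (z + w) = complex.Re z + complex.Re w.
Proof. by case: z w => [a b] [c d]. Qed.
Lemma cImD z w : complex.Im (z + w) = complex.Im z + complex.Im w.
Proof. by case: z w => [a b] [c d]. Qed.
Lemma cReN z : complex.Re (- z) = - complex.Re z. Proof. by case: z. Qed.
Lemma cImN z : complex.Im (- z) = - complex.Im z. Proof. by case: z. Qed.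
Definition ReImE := (cReM, cImM, cReD, cImD, cReN, cImN).

Lemma complex_ext z w : complex.Re z = complex.Re w -> complex.Im z = complex.Im w -> z = w.
Proof. by case: z w => [a b] [c d] /= -> ->. Qed.

Lemma norm_ReC z : (`|complex.Re z|)%:C <= `|z|.
Proof.
case: z => a b; rewrite normc_def lecR /= -sqrtr_sqr ler_wsqrtr //.
by rewrite lerDl sqr_ge0.
Qed.

Lemma norm_ImC z : (`|complex.Im z|)%:C <= `|z|.
Proof.
case: z => a b; rewrite normc_def lecR /= -sqrtr_sqr ler_wsqrtr //.
by rewrite lerDr sqr_ge0.
Qed.

Lemma normC_leD z : `|z| <= (`|complex.Re z| + `|complex.Im z|)%:C.
Proof.
case: z => a b /=.
have -> : a +i* b = a%:C + 'i * b%:C by rewrite {1}[a +i* b]complexE.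
apply: le_trans (ler_normD _ _) _; rewrite normrM.
rewrite !normc_def /= expr1n !(expr0n, addr0, add0r) /= sqrtr1 mul1r !sqrtr_sqr.
by rewrite -rmorphD.
Qed.

Lemma norm_realP z : exists r : R, `|z| = r%:C.
Proof. by eexists; rewrite normc_def. Qed.

Lemma normC_real (x : R) : `|x%:C| = `|x|%:C.
Proof. by rewrite normc_def /= expr0n addr0 sqrtr_sqr. Qed.

Lemma cexpD z w : cexp (z + w) = cexp z * cexp w.
Proof.
rewrite /cexp cReD cImD expRD cosD sinD.
by apply: complex_ext; rewrite !ReImE /=; ring.
Qed.

Lemma cexp0 : cexp 0 = 1 :> C.
Proof. by rewrite /cexp /= expR0 cos0 sin0; apply: complex_ext => /=; ring. Qed.

Lemma cexp_neq0 z : cexp z != 0.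
Proof.
apply/eqP => E; have := cexpD z (- z); rewrite subrr cexp0 E mul0r.
by move/eqP; rewrite oner_eq0.
Qed.

Lemma norm_cexp z : `|cexp z| = (expR (complex.Re z))%:C.
Proof.
rewrite /cexp normrM normC_real (ger0_norm (expR_ge0 _)) normc_def /= cos2Dsin2.
by rewrite sqrtr1 mulr1.
Qed.

(** [g] is the derivative of the path [f].  Working with real and imaginary parts
    reduces products, inverses and exponentials of paths to real calculus. *)
Definition pder f g := forall t,
  is_derive t (1 : R) (fun s => complex.Re (f s)) (complex.Re (g t)) /\
  is_derive t (1 : R) (fun s => complex.Im (f s)) (complex.Im (g t)).

Lemma is_derive1D (a b : R -> R) a' b' t : is_derive t (1 : R) a a' ->
  is_derive t (1 : R) b b' -> is_derive t (1 : R) (fun s => a s + b s) (a' + b').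
Proof. exact: is_deriveD. Qed.

Lemma is_derive1N (a : R -> R) a' t : is_derive t (1 : R) a a' ->
  is_derive t (1 : R) (fun s => - a s) (- a').
Proof. exact: is_deriveN. Qed.

Lemma is_derive1M (a b : R -> R) a' b' t : is_derive t (1 : R) a a' ->
  is_derive t (1 : R) b b' ->
  is_derive t (1 : R) (fun s => a s * b s) (a' * b t + a t * b').
Proof.
move=> Ha Hb; apply: is_derive_eq (is_deriveM Ha Hb) _.
by rewrite /GRing.scale /=; ring.
Qed.

Lemma pder_eq f g h : pder f g -> g =1 h -> pder f h.
Proof. by move=> fg gh t; rewrite -gh. Qed.

Lemma pder_cst z : pder (fun=> z) (fun=> 0).
Proof. by move=> t; split; exact: is_derive_cst. Qed.

Lemma pder_real : pder (fun t => t%:C) (fun=> 1).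
Proof. by move=> t; split; [exact: is_derive_id | exact: is_derive_cst]. Qed.

Lemma pderD f g f' g' : pder f f' -> pder g g' ->
  pder (fun t => f t + g t) (fun t => f' t + g' t).
Proof.
move=> Hf Hg t; have [f1 f2] := Hf t; have [g1 g2] := Hg t; split.
  under eq_fun do rewrite cReD.
  by rewrite cReD; apply: is_derive1D.
under eq_fun do rewrite cImD.
by rewrite cImD; apply: is_derive1D.
Qed.

Lemma pderM f g f' g' : pder f f' -> pder g g' ->
  pder (fun t => f t * g t) (fun t => f' t * g t + f t * g' t).
Proof.
move=> Hf Hg t; have [f1 f2] := Hf t; have [g1 g2] := Hg t; split.
  under eq_fun do rewrite cReM.
  apply: is_derive_eq (is_derive1D (is_derive1M f1 g1) (is_derive1N (is_derive1M f2 g2))) _.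
  by rewrite !ReImE; ring.
under eq_fun do rewrite cImM.
apply: is_derive_eq (is_derive1D (is_derive1M f1 g2) (is_derive1M f2 g1)) _.
by rewrite !ReImE; ring.
Qed.

Lemma pder_cexp f f' : pder f f' -> pder (fun t => cexp (f t)) (fun t => f' t * cexp (f t)).
Proof.
move=> Hf.
have H1 : pder (fun t => (expR (complex.Re (f t)))%:C)
    (fun t => (expR (complex.Re (f t)) * complex.Re (f' t))%:C).
  move=> t; split; last exact: is_derive_cst.
  by have [f1 _] := Hf t; apply: is_derive1_comp.
have H2 : pder (fun t => cos (complex.Im (f t)) +i* sin (complex.Im (f t)))
    (fun t => (complex.Im (f' t))%:C * (- sin (complex.Im (f t)) +i* cos (complex.Im (f t)))).
  move=> t; have [_ f2] := Hf t; split.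
    apply: is_derive_eq (is_derive1_comp (is_derive_cos _) f2) _.
    by rewrite /=; ring.
  apply: is_derive_eq (is_derive1_comp (is_derive_sin _) f2) _.
  by rewrite /=; ring.
apply: pder_eq (pderM H1 H2) _ => t; rewrite /cexp.
by apply: complex_ext; rewrite !ReImE /=; ring.
Qed.

Lemma pderV f f' : pder f f' -> (forall t, f t != 0) ->
  pder (fun t => (f t)^-1) (fun t => - (f' t * (f t)^-1 ^+ 2)).
Proof.
move=> Hf f0.
pose d t := complex.Re (f t) ^+ 2 + complex.Im (f t) ^+ 2.
have d0 t : d t != 0.
  rewrite /d paddr_eq0 ?sqr_ge0 // !sqrf_eq0; have := f0 t.
  by case: (f t) => a b; rewrite eq_complex.
pose d' t := complex.Re (f t) * complex.Re (f' t) *+ 2 + complex.Im (f t) * complex.Im (f' t) *+ 2.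
have Hd t : is_derive t (1 : R) d (d' t).
  have [f1 f2] := Hf t.
  apply: is_derive_eq (is_derive1D (is_derive1M f1 f1) (is_derive1M f2 f2)) _.
  by rewrite /d'; ring.
have HV : pder (fun t => (d t)^-1%:C) (fun t => (- (d t)^-1 ^+ 2 * d' t)%:C).
  move=> t; split; last exact: is_derive_cst.
  apply: is_derive_eq (is_deriveV (d0 t) (Hd t)) _.
  by rewrite /GRing.scale /= exprVn.
have HC : pder (fun t => (f t)^*) (fun t => (f' t)^*).
  move=> t; have [f1 f2] := Hf t; split.
    have <- : complex.Re (f' t) = complex.Re (f' t)^* by case: (f' t).
    by rewrite (_ : (fun s => _) = (fun s => complex.Re (f s))) //; apply: funext => s; case: (f s).
  have -> : complex.Im (f' t)^* = - complex.Im (f' t) by case: (f' t).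
  rewrite (_ : (fun s => _) = (fun s => - complex.Im (f s))); first exact: is_derive1N.
  by apply: funext => s; case: (f s).
have fV t : (f t)^-1 = (f t)^* * (d t)^-1%:C.
  rewrite /d; case: (f t) => a b; apply: complex_ext; rewrite !ReImE /=; ring.
rewrite (_ : (fun t => (f t)^-1) = fun t => (f t)^* * (d t)^-1%:C); last exact/funext.
apply: pder_eq (pderM HC HV) _ => t; rewrite fV.
have := d0 t; rewrite /d' /d; case: (f t) (f' t) => a b [a' b'] /= D.
by apply: complex_ext; rewrite !ReImE /=; field.
Qed.

Lemma pderX n f f' : pder f f' ->
  pder (fun t => f t ^+ n) (fun t => n%:R * f t ^+ n.-1 * f' t).
Proof.
move=> Hf; elim: n => [|n IHn].
  by apply: pder_eq (pder_cst 1) _ => t; rewrite !mul0r.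
under eq_fun do rewrite exprS.
apply: pder_eq (pderM Hf IHn) _ => t /=.
by case: n {IHn} => [|n] /=; rewrite ?expr0 ?exprS -?natr1; ring.
Qed.

Lemma pder_horner p f f' : pder f f' ->
  pder (fun t => p.[f t]) (fun t => p^`().[f t] * f' t).
Proof.
move=> Hf; elim/poly_ind: p => [|p c IHp].
  under eq_fun do rewrite horner0.
  by apply: pder_eq (pder_cst 0) _ => t; rewrite deriv0 horner0 mul0r.
under eq_fun do rewrite hornerMXaddC.
apply: pder_eq (pderD (pderM IHp Hf) (pder_cst c)) _ => t.
by rewrite derivD derivM derivX derivC mulr1 !hornerE /=; ring.
Qed.

Definition pcont f := continuous (fun s => complex.Re (f s)) /\
  continuous (fun s => complex.Im (f s)).

Lemma pder_cont f g : pder f g -> pcont f.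
Proof.
by move=> H; split=> t; have [[h1 _] [h2 _]] := H t;
  apply/differentiable_continuous/derivable1_diffP.
Qed.

End Paths.

(** * Taylor estimates and quadratic differentiability *)

(** An order argument replaces the limit [h -> 0]: test at the point
    [h = rho L / (rho B + L)], where [B h < L]. *)
Lemma small_eq0 (F : numFieldType) (L B rho : F) : 0 <= L -> 0 < rho ->
  (forall h : F, h != 0 -> `|h| <= rho -> L <= B * `|h|) -> L = 0.
Proof.
move=> L0 r0 H.
have B0 : 0 <= B.
  have r1 : rho != 0 by rewrite gt_eqF.
  have := H rho r1; rewrite (ger0_norm (ltW r0)) => /(_ (lexx _)) /(le_trans L0).
  by rewrite pmulr_lge0.
apply/eqP; apply/negP => /negP Ln.
have Lp : 0 < L by rewrite lt_def Ln.
have D0 : 0 < rho * B + L by rewrite ltr_wpDl // mulr_ge0 // ltW.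
have h0 : 0 < rho * L / (rho * B + L) by rewrite divr_gt0 // mulr_gt0.
have h1 : rho * L / (rho * B + L) <= rho.
  rewrite ler_pdivrMr // ler_pM2l // lerDr mulr_ge0 // ltW //.
have := H (rho * L / (rho * B + L)); rewrite gt_eqF // (ger0_norm (ltW h0)) => /(_ isT h1).
rewrite mulrA ler_pdivlMr // mulrDr (_ : B * (rho * L) = L * (rho * B)); last by ring.
by rewrite gerDl; apply/negP; rewrite lt_geF // mulr_gt0.
Qed.

Lemma derive1_quadratic (F : numFieldType) (f r : F -> F) (x l K : F) :
  (forall h, `|h| <= 1 -> f (x + h) = f x + l * h + r h * h ^+ 2 /\ `|r h| <= K) ->
  derive1 f x = l.
Proof.
move=> H; rewrite /derive1.
apply: cvg_lim; first exact: norm_hausdorff.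
apply/cvgrPdist_le => e e0 /=.
have K0 : 0 <= K.
  have h1 : `|1 : F| <= 1 by rewrite normr1.
  by have [_] := H 1 h1; apply: le_trans.
have K1 : 0 < K + 1 by rewrite ltr_wpDl.
have d0 : 0 < e / (K + 1) by rewrite divr_gt0.
near=> h.
have h0 : h != 0 by near: h; exact: nbhs_dnbhs_neq.
have h1 : `|h| <= 1 by near: h; apply: dnbhs0_le.
have he : `|h| <= e / (K + 1) by near: h; apply: dnbhs0_le.
have [e1 b] := H h h1.
rewrite [h + x]addrC e1 distrC.
have -> : h^-1 *: (f x + l * h + r h * h ^+ 2 - f x) - l = r h * h.
  by rewrite /GRing.scale /=; field.
rewrite normrM; apply: le_trans (ler_pM _ _ b he) _ => //.
rewrite mulrA ler_pdivrMr // mulrC ler_wpM2l ?ltW //.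
by rewrite ltrDl.
Unshelve. all: by end_near. Qed.

Section Taylor.
Variable R : realType.
Local Notation C := R[i].
Implicit Types (z w u v : C).

(** The factor [2] comes from applying the real theorem to the two components. *)
Lemma mean_value (f g : R -> C) (M : R) : pder f g ->
  (forall t, 0 < t < 1 -> `|g t| <= M%:C) -> `|f 1 - f 0| <= (M *+ 2)%:C.
Proof.
move=> H B; have [cR cI] := pder_cont H.
have key (a b : R -> R) : (forall t, is_derive t (1 : R) a (b t)) ->
   (forall t, 0 < t < 1 -> `|b t| <= M) -> `|a 1 - a 0| <= M.
  move=> Ha Hb.
  have ca : continuous a.
    by move=> t; have [h1 _] := Ha t; apply/differentiable_continuous/derivable1_diffP.
  have [c] := MVT ltr01 (fun x _ => Ha x) (continuous_subspaceT ca).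
  by rewrite in_itv /= subr0 mulr1 => /Hb Hc ->.
apply: le_trans (normC_leD _) _; rewrite lecR mulr2n; apply: lerD.
  rewrite !ReImE; apply: (key (fun t => complex.Re (f t)) (fun t => complex.Re (g t))).
    by move=> t; have [] := H t.
  by move=> t /B; rewrite -lecR; apply: le_trans; exact: norm_ReC.
rewrite !ReImE; apply: (key (fun t => complex.Im (f t)) (fun t => complex.Im (g t))).
  by move=> t; have [] := H t.
by move=> t /B; rewrite -lecR; apply: le_trans; exact: norm_ImC.
Qed.

Definition texp M : {poly C} := \poly_(k < M) k`!%:R^-1.

Lemma deriv_texp M : (texp M.+1)^`() = texp M.
Proof.
apply/polyP => i; rewrite coef_deriv !coef_poly ltnS.
case: ltnP => // _; last by rewrite mul0rn.
by rewrite factS natrM invfM -[LHS]mulr_natl mulrA divff ?mul1r // pnatr_eq0.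
Qed.

Lemma texp_at0 M : (texp M.+1).[0] = 1.
Proof. by rewrite horner_coef0 coef_poly /= invr1. Qed.

Lemma texp2E h : (texp 2).[h] = 1 + h.
Proof.
rewrite /texp poly_def !big_ord_recl big_ord0 /= addr0 !hornerE /=.
by rewrite !invr1; ring.
Qed.

(** By induction: [R_{M+1}(h) = e^h - T_{M+1}(h)] has derivative [R_M] and vanishes
    at [0], so the mean value theorem on the segment from [0] to [h] raises the order
    by one.  The bound is uniform on each disc, as is needed on a contour. *)
Lemma cexp_taylor (B : R) M : exists K : R,
  forall h, `|h| <= B%:C -> `|cexp h - (texp M).[h]| <= K%:C * `|h| ^+ M.
Proof.
elim: M => [|M [K HK]].
  exists (expR B) => h hB; rewrite /texp poly_def big_ord0 horner0 subr0 expr0 mulr1.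
  rewrite norm_cexp lecR ler_expR -lecR; apply: le_trans hB.
  apply: le_trans (norm_ReC h); rewrite lecR; exact: ler_norm.
exists (K *+ 2) => h hB.
pose f (t : R) : C := cexp (h * t%:C) - (texp M.+1).[h * t%:C].
have Hl : pder (fun t : R => h * t%:C) (fun=> h).
  apply: pder_eq (pderM (pder_cst h) (@pder_real R)) _ => t.
  by rewrite mul0r add0r mulr1.
have Hf : pder f (fun t => h * (cexp (h * t%:C) - (texp M).[h * t%:C])).
  have Hm : pder (fun t => -1 * (texp M.+1).[h * t%:C]) (fun t => - (h * (texp M).[h * t%:C])).
    apply: pder_eq (pderM (pder_cst (-1)) (pder_horner (texp M.+1) Hl)) _ => t.
    by rewrite deriv_texp mul0r add0r mulN1r mulrC.
  rewrite (_ : f = fun t => cexp (h * t%:C) + -1 * (texp M.+1).[h * t%:C]); last first.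
    by apply: funext => t; rewrite mulN1r.
  by apply: pder_eq (pderD (pder_cexp Hl) Hm) _ => t; rewrite mulrBr.
have [r rE] := norm_realP h.
have := @mean_value _ _ (K * r ^+ M.+1) Hf.
rewrite /f rmorph1 rmorph0 mulr1 mulr0 cexp0 texp_at0 subrr subr0 => H.
apply: le_trans (H _) _; last first.
  by rewrite rE -rmorphXn -rmorphM lecR mulrnAl.
move=> t /andP[t0 t1]; rewrite normrM rE.
have ht : `|h * t%:C| = (r * t)%:C.
  by rewrite normrM normC_real rE rmorphM /= ger0_norm // ltW.
have r0 : 0 <= r by rewrite -lecR -rE normr_ge0.
have K0 : 0 <= K * r ^+ M.
  have := HK h hB; rewrite rE -rmorphXn -rmorphM /= => /(le_trans (normr_ge0 _)).
  by rewrite ler0c.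
have : `|h * t%:C| <= B%:C.
  rewrite ht; apply: le_trans hB; rewrite rE lecR.
  by rewrite ler_piMr // ltW.
move/HK; rewrite ht -rmorphXn -rmorphM /= => HK'.
apply: le_trans (ler_wpM2l _ HK') _; first by rewrite ler0c.
rewrite -rmorphM lecR.
have -> : r * (K * (r * t) ^+ M) = K * r ^+ M * r * t ^+ M by rewrite exprMn; ring.
have Kr0 : 0 <= K * r ^+ M * r by apply: mulr_ge0.
by rewrite exprSr mulrA ler_piMr // exprn_ile1 // ltW.
Qed.

Implicit Types f g : C -> C.

(** [l] is the complex derivative of [f] at [x], with a remainder of order two:
    more than a derivative needs, but stable under products without any limit
    argument, and what the Taylor estimate provides. *)
Definition qdiff f (x l : C) := exists (K : C) (r : C -> C),
  forall h : C, `|h| <= 1 -> f (x + h) = f x + l * h + r h * h ^+ 2 /\ `|r h| <= K.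

Lemma qdiff_bound f x l (K : C) :
  (forall h : C, `|h| <= 1 -> `|f (x + h) - f x - l * h| <= K * `|h| ^+ 2) -> qdiff f x l.
Proof.
move=> H; exists (`|K|), (fun h => (f (x + h) - f x - l * h) / h ^+ 2) => h h1.
have [->|h0] := eqVneq h 0.
  by rewrite addr0 expr0n /= invr0 !mulr0 !addr0 normr0; split=> //; exact: normr_ge0.
have h20 : h ^+ 2 != 0 by rewrite expf_eq0.
split; first by rewrite divfK //; ring.
rewrite normrM normfV normrX ler_pdivrMr ?exprn_gt0 ?normr_gt0 //.
apply: le_trans (H h h1) _; rewrite ler_wpM2r ?exprn_ge0 ?normr_ge0 //.
have := H h h1; move/(le_trans (normr_ge0 _)); rewrite pmulr_lge0 ?exprn_gt0 ?normr_gt0 //.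
by move=> K0; rewrite ger0_norm.
Qed.

Lemma qdiff_eq f x l l' : qdiff f x l -> l = l' -> qdiff f x l'.
Proof. by move=> H <-. Qed.

Lemma qdiff_cst c x : qdiff (fun=> c) x 0.
Proof. by exists 0, (fun=> 0) => h _; rewrite !mul0r !addr0 normr0. Qed.

Lemma qdiff_id x : qdiff id x 1.
Proof. by exists 0, (fun=> 0) => h _; rewrite mul0r mul1r addr0 normr0. Qed.

Lemma qdiffD f g x l l' : qdiff f x l -> qdiff g x l' ->
  qdiff (fun y => f y + g y) x (l + l').
Proof.
move=> [K [r H]] [K' [r' H']]; exists (K + K'), (fun h => r h + r' h) => h h1.
have [-> b] := H h h1; have [-> b'] := H' h h1; split; first ring.
by apply: le_trans (ler_normD _ _) _; apply: lerD.
Qed.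

Lemma qdiffM f g x l l' : qdiff f x l -> qdiff g x l' ->
  qdiff (fun y => f y * g y) x (l * g x + f x * l').
Proof.
move=> [K [r H]] [K' [r' H']].
exists (`|f x| * K' + K * `|g x| + `|l * l'| + `|l| * K' + K * `|l'| + K * K'),
  (fun h => f x * r' h + r h * g x + l * l' + l * r' h * h + r h * l' * h + r h * r' h * h ^+ 2) => h h1.
have [-> b] := H h h1; have [-> b'] := H' h h1; split; first ring.
have K0 := le_trans (normr_ge0 _) b; have K0' := le_trans (normr_ge0 _) b'.
have shrink u v : `|v| <= 1 -> `|u * v| <= `|u|.
  by move=> v1; rewrite normrM ler_piMr.
have h2 : `|h ^+ 2| <= 1 by rewrite normrX exprn_ile1.
do 5?(apply: le_trans (ler_normD _ _) _; apply: lerD).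
- by rewrite normrM ler_wpM2l.
- by rewrite normrM ler_wpM2r.
- by [].
- by apply: le_trans (shrink _ _ h1) _; rewrite normrM ler_wpM2l.
- by apply: le_trans (shrink _ _ h1) _; rewrite normrM ler_wpM2r.
- by apply: le_trans (shrink _ _ h2) _; rewrite normrM ler_pM.
Qed.

Lemma qdiff_horner (p : {poly C}) x : qdiff (fun y => p.[y]) x p^`().[x].
Proof.
elim/poly_ind: p => [|p c IHp].
  by under eq_fun do rewrite horner0; rewrite deriv0 horner0; apply: qdiff_cst.
under eq_fun do rewrite hornerMXaddC.
apply: qdiff_eq (qdiffD (qdiffM IHp (qdiff_id x)) (qdiff_cst c x)) _.
by rewrite derivD derivM derivX derivC !mulr1 !addr0 !(hornerD, hornerM, hornerX).
Qed.

Lemma qdiff_cexp k x : qdiff (fun y => cexp (k * y)) x (k * cexp (k * x)).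
Proof.
have [B BE] := norm_realP k.
have [K HK] := cexp_taylor B 2.
apply: (@qdiff_bound _ _ _ (`|cexp (k * x)| * K%:C * `|k| ^+ 2)) => h h1.
have -> : cexp (k * (x + h)) - cexp (k * x) - k * cexp (k * x) * h =
    cexp (k * x) * (cexp (k * h) - (texp 2).[k * h]).
  by rewrite mulrDr cexpD texp2E; ring.
have -> : `|cexp (k * x)| * K%:C * `|k| ^+ 2 * `|h| ^+ 2 =
    `|cexp (k * x)| * (K%:C * `|k * h| ^+ 2) by rewrite [`|k * h|]normrM exprMn !mulrA.
rewrite [X in X <= _]normrM ler_wpM2l //; apply: HK.
by rewrite normrM -BE ler_piMr.
Qed.

Lemma qdiff_uniq f x l l' : qdiff f x l -> qdiff f x l' -> l = l'.
Proof.
move=> [K [r H]] [K' [r' H']]; apply/eqP; rewrite -subr_eq0 -normr_eq0; apply/eqP.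
apply: (@small_eq0 _ _ (K + K') 1) => // h h0 h1.
have [e b] := H h h1; have [e' b'] := H' h h1.
have : (l - l') * h = (r' h - r h) * h * h.
  apply/eqP; rewrite -subr_eq0.
  have -> : (l - l') * h - (r' h - r h) * h * h =
    (f x + l * h + r h * h ^+ 2) - (f x + l' * h + r' h * h ^+ 2) by ring.
  by rewrite -e -e' subrr.
move/(mulIf h0) => ->; rewrite normrM ler_wpM2r //.
by apply: le_trans (ler_normB _ _) _; rewrite addrC lerD.
Qed.

Lemma qdiff_cderive f x l : qdiff f x l -> cderive f x = l.
Proof. by case=> K [r H]; apply: derive1_quadratic H. Qed.

End Taylor.

(** * From exponents to the differential equation *)

Lemma cvg_dnbhs_bound (F : numFieldType) (f : F -> F) (z l e : F) : 0 < e ->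
  f x @[x --> z^'] --> l ->
  exists2 rho, 0 < rho & forall h, h != 0 -> `|h| < rho -> `|l - f (z + h)| <= e.
Proof.
move=> e0 /cvgrPdist_le /(_ e e0) /nbhs_normP [rho /= r0 H].
exists rho => // h h0 hr; apply: (H (z + h)) => /=.
  by rewrite opprD addrA subrr sub0r normrN.
by rewrite -subr_eq0 addrC addrA addNr add0r.
Qed.

Section Spaces.
Variable R : realType.
Local Notation C := R[i].
Implicit Types (f g : C -> C).

Lemma cspan_pairP f g h : cspan [set f; g] h <->
  exists a b : C, h = fun x => a * f x + b * g x.
Proof.
split; last first.
  move=> [a [b ->]].
  exists 2%N, (fun k => if k == 0 then a else b), (fun k => if k == 0 then f else g).
  split; first by move=> k; case: ifP => _; [left | right].
  by apply: funext => x; rewrite !big_ord_recl big_ord0 /= addr0.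
move=> [d [a [k [Hk ->]]]].
have : forall i, exists uv : C * C, k i = fun x => uv.1 * f x + uv.2 * g x.
  move=> i; case: (Hk i) => ->; [exists (1, 0)|exists (0, 1)]; apply: funext => x /=.
    by rewrite mul1r mul0r addr0.
  by rewrite mul1r mul0r add0r.
move/choice => [uv Huv].
exists (\sum_i a i * (uv i).1), (\sum_i a i * (uv i).2); apply: funext => x.
rewrite !mulr_suml -big_split /=; apply: eq_bigr => i _.
by rewrite Huv; ring.
Qed.

Lemma qdiff_local_bound f x l : qdiff f x l -> exists2 K : C, 0 <= K &
  forall h : C, `|h| <= 1 -> `|f (x + h)| <= K.
Proof.
move=> [K [r H]]; exists (`|f x| + `|l| + `|K|); first by rewrite !addr_ge0.
move=> h h1; have [-> b] := H h h1.
apply: le_trans (ler_normD _ _) _; apply: lerD; last first.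
  rewrite normrM normrX; apply: le_trans (_ : `|r h| <= _).
    by rewrite ler_piMr // exprn_ile1.
  by rewrite [`|K|]ger0_norm // (le_trans (normr_ge0 _) b).
apply: le_trans (ler_normD _ _) _; rewrite lerD2l normrM.
by rewrite ler_piMr.
Qed.

(** If [(x - z)^j] divides [P] with [j < k], the cofactor is [O(h)], hence vanishes
    at [z]. *)
Lemma bigO_dvdp (P : {poly C}) z k (K rho : C) : 0 < rho ->
  (forall h : C, h != 0 -> `|h| <= rho -> `|P.[z + h]| <= K * `|h| ^+ k) ->
  ('X - z%:P) ^+ k %| P.
Proof.
move=> r0 H; suff: forall j, (j <= k)%N -> ('X - z%:P) ^+ j %| P by apply.
elim=> [|j IHj] jk; first by rewrite expr0 dvd1p.
have /dvdpP [Q PE] := IHj (ltnW jk).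
rewrite PE exprS dvdp_mul2r ?expf_neq0 ?polyXsubC_eq0 // dvdp_XsubCl rootE -normr_eq0.
have [K' [r Hr]] := qdiff_horner Q z.
pose rho' : C := rho / (1 + rho).
have rho'0 : 0 < rho' by rewrite divr_gt0 // addr_gt0.
have rho'1 : rho' <= 1 by rewrite ler_pdivrMr ?addr_gt0 // mul1r lerDr.
have rho'r : rho' <= rho.
  by rewrite ler_pdivrMr ?addr_gt0 // ler_peMr ?ltW // ltrDl.
apply/eqP; apply: (@small_eq0 _ _ (`|K| + `|Q^`().[z]| + `|K'|) rho') => // h h0 hr.
have h1 : `|h| <= 1 by apply: le_trans rho'1.
have [Qh b] := Hr h h1.
have b1 : `|Q.[z + h]| <= `|K| * `|h|.
  have hp : 0 < `|h| ^+ j by rewrite exprn_gt0 // normr_gt0.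
  rewrite -(ler_pM2r hp) -normrX -normrM.
  have -> : Q.[z + h] * h ^+ j = P.[z + h].
    by rewrite PE hornerM horner_exp hornerXsubC [z + h - z]addrAC subrr add0r.
  apply: le_trans (H h h0 (le_trans hr rho'r)) _.
  have K0 : 0 <= K.
    have := H h h0 (le_trans hr rho'r); move/(le_trans (normr_ge0 _)).
    by rewrite pmulr_lge0 // exprn_gt0 // normr_gt0.
  rewrite (ger0_norm K0) -mulrA ler_wpM2l // normrX -exprS.
  by rewrite ler_wiXn2l.
have -> : Q.[z] = Q.[z + h] - Q^`().[z] * h - r h * h ^+ 2 by rewrite Qh; ring.
rewrite !mulrDl; apply: le_trans (ler_normB _ _) _; apply: lerD.
  by apply: le_trans (ler_normB _ _) _; rewrite lerD // normrM.
rewrite normrM normrX; apply: ler_pM => //.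
  by rewrite [`|K'|]ger0_norm // (le_trans (normr_ge0 _) b).
by rewrite expr2 ler_piMr.
Qed.

(** With [T] the Taylor polynomial of degree [k + 1], the polynomial [P] of [indicial]
    differs from the function, divided by [e^{l_1 x}], by a term of order [k + 2], so
    it is [O(h^{k+1})] too. *)
Lemma indicial_of_order (l : C * C) z k (p1 p2 : {poly C}) (A B : C) : A != 0 ->
  has_order (fun x => A * quasi_exp p1 l.1 x + B * quasi_exp p2 l.2 x) z k.+1%:Z ->
  ('X - z%:P) ^+ k %| twWr l p1 p2 /\
  ('X - z%:P) ^+ k %| ('X - z%:P) * twWrD l p1 p2.
Proof.
move=> A0 [c _] /(cvg_dnbhs_bound ltr01) [rho r0 Hf].
pose f x : C := A * quasi_exp p1 l.1 x + B * quasi_exp p2 l.2 x.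
pose La := l.2 - l.1.
pose T : {poly C} := cexp (La * z) *: (texp R k.+2 \Po (La *: ('X - z%:P))).
pose S : {poly C} := - (cexp (La * z) * La ^+ k.+2 / k.+1`!%:R)%:P.
have dT : T^`() = La *: T + ('X - z%:P) ^+ k.+1 * S.
  rewrite /T derivZ deriv_comp deriv_texp derivZ derivXsubC.
  have -> : texp R k.+1 = texp R k.+2 - k.+1`!%:R^-1 *: 'X^(k.+1).
    by rewrite /texp !poly_def [in RHS]big_ord_recr /= addrK.
  rewrite comp_polyB comp_polyZ comp_Xn_poly /S exprZn [La ^+ k.+2]exprS -!mul_polyC.
  by rewrite !polyCM; ring.
apply: (indicial A0 dT (B := B)).
have [K1 K10 H1] := qdiff_local_bound (qdiff_cexp (- l.1) z).
have [K2 K20 H2] := qdiff_local_bound (qdiff_horner p2 z).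
have [La1 LaE] := norm_realP La.
have [K3 H3] := cexp_taylor La1 k.+2.
pose rho' : C := (rho / 2%:R) / (1 + rho / 2%:R).
have rh0 : 0 < rho / 2%:R by rewrite divr_gt0.
have rho'0 : 0 < rho' by rewrite divr_gt0 // addr_gt0.
have rho'1 : rho' <= 1 by rewrite ler_pdivrMr ?addr_gt0 // mul1r lerDr.
have rho'r : rho' < rho.
  apply: le_lt_trans (_ : rho / 2%:R < _).
    by rewrite ler_pdivrMr ?addr_gt0 // ler_peMr ?ltW // ltrDl.
  by rewrite ltr_pdivrMr // ltr_pMr // ltr1n.
pose K : C := (`|c| + 1) * K1 + `|B| * K2 * `|cexp (La * z)| * (`|K3%:C| * `|La| ^+ k.+2).
apply: (bigO_dvdp (K := K) rho'0) => h h0 hr.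
have h1 : `|h| <= 1 := le_trans hr rho'1.
have -> : (A *: p1 + B *: (p2 * T)).[z + h] =
   f (z + h) * cexp (- l.1 * (z + h))
   - B * p2.[z + h] * cexp (La * z) * (cexp (La * h) - (texp R k.+2).[La * h]).
  rewrite !(hornerD, hornerZ, hornerM) horner_comp !(hornerZ, hornerXsubC).
  rewrite (_ : z + h - z = h); last by rewrite addrAC subrr add0r.
  have E1 : cexp (l.1 * (z + h)) * cexp (- l.1 * (z + h)) = 1 :> C.
    by rewrite -cexpD mulNr subrr cexp0.
  have E2 : cexp (l.2 * (z + h)) * cexp (- l.1 * (z + h)) = cexp (La * z) * cexp (La * h) :> C.
    by rewrite -!cexpD; congr cexp; rewrite /La; ring.
  rewrite /f /quasi_exp; cbv beta.
  transitivity (A * p1.[z + h] * (cexp (l.1 * (z + h)) * cexp (- l.1 * (z + h)))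
    + B * p2.[z + h] * (cexp (l.2 * (z + h)) * cexp (- l.1 * (z + h)))
    - B * p2.[z + h] * cexp (La * z) * (cexp (La * h) - (texp R k.+2).[La * h])).
    by rewrite E1 E2; ring.
  by ring.
apply: le_trans (ler_normB _ _) _; rewrite /K [X in _ <= X]mulrDl; apply: lerD.
  rewrite normrM [X in _ <= X]mulrAC; apply: ler_pM => //; last exact: H1.
  have := Hf h h0 (le_lt_trans hr rho'r); rewrite [z + h - z]addrAC subrr add0r => Hf'.
  have hk0 : 0 < `|h| ^+ k.+1 by rewrite exprn_gt0 // normr_gt0.
  rewrite -ler_pdivrMr // -normrX -normrV ?unitfE ?expf_neq0 // -normrM.
  rewrite -[f _ / _](subKr c); apply: le_trans (ler_normB _ _) _.
  by rewrite lerD2l.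
have Hh : `|La * h| <= La1%:C by rewrite normrM -LaE ler_piMr.
rewrite [X in X <= _]normrM -[X in _ <= X]mulrA; apply: ler_pM => //.
  by rewrite !normrM ler_wpM2r // ler_wpM2l // H2.
apply: le_trans (H3 _ Hh) _; apply: le_trans (_ : `|K3%:C| * `|La * h| ^+ k.+2 <= _).
  by rewrite ler_wpM2r ?exprn_ge0 // normC_real lecR ler_norm.
have K3La : 0 <= `|K3%:C| * `|La| ^+ k.+2 by apply: mulr_ge0; rewrite ?exprn_ge0.
by rewrite [`|La * h|]normrM exprMn mulrA ler_wpM2l // ler_wiXn2l.
Qed.

Lemma order_neq0 z k f : has_order f z k -> exists x, f x != 0.
Proof.
move=> [l l0]; have e0 : 0 < `|l| / 2%:R by rewrite divr_gt0 ?normr_gt0.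
move=> /(cvg_dnbhs_bound e0) [rho r0 H]; apply/not_existsP => f0.
have h0 : 0 < rho / 2%:R by rewrite divr_gt0.
have := H (rho / 2%:R); rewrite gt_eqF // (ger0_norm (ltW h0)).
move=> /(_ isT); have -> : rho / 2%:R < rho by rewrite ltr_pdivrMr // ltr_pMr // ltr1n.
have /negP := f0 (z + rho / 2%:R); rewrite negbK => /eqP ->.
rewrite mul0r subr0 => /(_ isT); apply/negP; rewrite lt_geF //.
by rewrite ltr_pdivrMr // ltr_pMr ?normr_gt0 // ltr1n.
Qed.

(** A function of exponent [k + 1] is not zero, so one of its two coefficients is
    not zero; the determinants are antisymmetric. *)
Lemma exponent_indicial (l : C * C) z k (p1 p2 : {poly C}) :
  exponents (cspan [set quasi_exp p1 l.1; quasi_exp p2 l.2]) z k.+1%:Z ->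
  ('X - z%:P) ^+ k %| twWr l p1 p2 /\
  ('X - z%:P) ^+ k %| ('X - z%:P) * twWrD l p1 p2.
Proof.
move=> [f /cspan_pairP [a [b ->]]] Hf.
have [a0|a0] := eqVneq a 0; last exact: indicial_of_order a0 Hf.
have b0 : b != 0.
  apply/eqP => b0; have [x] := order_neq0 Hf.
  by rewrite a0 b0 !mul0r addr0 eqxx.
have := @indicial_of_order (l.2, l.1) z k p2 p1 b a b0.
rewrite twWr_swap twWrD_swap mulrN !dvdpNr; apply.
by under eq_fun do rewrite addrC.
Qed.

(** Only the larger exponents, at [z_1] and [z_2], enter: with the degrees they
    already determine the Wronskian. *)
Lemma space_ode (l z : C * C) (n m : nat * nat) V (p1 p2 : {poly C}) :
  (n.1 + n.2 = m.1 + m.2)%N -> l.1 != l.2 -> z.1 != z.2 ->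
  space_of_type l z n m V -> quasi_exp_space l n p1 p2 V ->
  (exists C0, twWr l p1 p2 = C0 *: (('X - z.1%:P) ^+ m.1 * ('X - z.2%:P) ^+ m.2)) /\
  exists a b, tw_ode l z m a b l.1 p1 /\ tw_ode l z m a b l.2 p2.
Proof.
move=> nm l12 z12 [_ _ e1 e2] [s1 s2 VE].
have [W1 N1] : ('X - z.1%:P) ^+ m.1 %| twWr l p1 p2 /\
    ('X - z.1%:P) ^+ m.1 %| ('X - z.1%:P) * twWrD l p1 p2.
  by apply: exponent_indicial; rewrite -VE e1; right.
have [W2 N2] : ('X - z.2%:P) ^+ m.2 %| twWr l p1 p2 /\
    ('X - z.2%:P) ^+ m.2 %| ('X - z.2%:P) * twWrD l p1 p2.
  by apply: exponent_indicial; rewrite -VE e2; right.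
exact: ode_of_indices nm l12 z12 s1 s2 W1 N1 W2 N2.
Qed.

Lemma qdiff_quasi_exp (p : {poly C}) l x :
  qdiff (quasi_exp p l) x (quasi_exp (twD l p) l x).
Proof.
apply: qdiff_eq (qdiffM (qdiff_horner p x) (qdiff_cexp l x)) _.
by rewrite /quasi_exp /twD hornerD hornerZ; ring.
Qed.

Lemma qdiff_comb (p q : {poly C}) (l : C * C) a b x :
  qdiff (fun y => a * quasi_exp p l.1 y + b * quasi_exp q l.2 y) x
    (a * quasi_exp (twD l.1 p) l.1 x + b * quasi_exp (twD l.2 q) l.2 x).
Proof.
apply: qdiff_eq (qdiffD (qdiffM (qdiff_cst a x) (qdiff_quasi_exp p l.1 x))
  (qdiffM (qdiff_cst b x) (qdiff_quasi_exp q l.2 x))) _.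
by rewrite !mul0r !add0r.
Qed.

Lemma wronskian_comb (p1 p2 : {poly C}) (l : C * C) a b c d x :
  wronskian (fun y => a * quasi_exp p1 l.1 y + b * quasi_exp p2 l.2 y)
            (fun y => c * quasi_exp p1 l.1 y + d * quasi_exp p2 l.2 y) x =
  (a * d - b * c) * (twWr l p1 p2).[x] * cexp ((l.1 + l.2) * x).
Proof.
rewrite /wronskian !(qdiff_cderive (qdiff_comb _ _ _ _ _ _)) /quasi_exp [(l.1 + l.2) * x]mulrDl cexpD.
have -> : (twWr l p1 p2).[x] = p1.[x] * (twD l.2 p2).[x] - (twD l.1 p1).[x] * p2.[x].
  by rewrite /twWr hornerD hornerN !hornerM.
by ring.
Qed.

End Spaces.

(** * Contour integrals depending on a parameter *)

Section ContourIntegral.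
Variable R : realType.
Local Notation C := R[i].
Implicit Types (f g : R -> C).

Local Notation I := (`[0, 2 * pi]%classic : set R).
Local Notation mu := (@lebesgue_measure R).

Lemma integrable_I (f : R -> R) : continuous f -> mu.-integrable I (EFin \o f).
Proof.
move=> cf; apply: continuous_compact_integrable; first exact: segment_compact.
exact: continuous_subspaceT.
Qed.

(** [circle_integral] is [cint] of a path, by conversion. *)
Definition cint f : C :=
  (\int[mu]_(t in I) complex.Re (f t))%R +i* (\int[mu]_(t in I) complex.Im (f t))%R.

Lemma Re_cint f : complex.Re (cint f) = \int[mu]_(t in I) complex.Re (f t).
Proof. by []. Qed.
Lemma Im_cint f : complex.Im (cint f) = \int[mu]_(t in I) complex.Im (f t).
Proof. by []. Qed.

Lemma cintD f g : pcont f -> pcont g -> cint (fun t => f t + g t) = cint f + cint g.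
Proof.
move=> [f1 f2] [g1 g2]; apply: complex_ext; rewrite ReImE !(Re_cint, Im_cint).
  under [LHS]eq_Rintegral do rewrite cReD.
  by rewrite RintegralD //; exact: integrable_I.
under [LHS]eq_Rintegral do rewrite cImD.
by rewrite RintegralD //; exact: integrable_I.
Qed.

Lemma cintZ c f : pcont f -> cint (fun t => c * f t) = c * cint f.
Proof.
move=> [f1 f2].
have cZ (a : R -> R) k : continuous a -> continuous (fun t => k * a t).
  by move=> ca t; apply: continuousM; [exact: cst_continuous | exact: ca].
apply: complex_ext; rewrite ReImE !(Re_cint, Im_cint).
  under [LHS]eq_Rintegral do rewrite cReM.
  rewrite RintegralB //; [|exact/integrable_I/cZ|exact/integrable_I/cZ].
  by rewrite !RintegralZl //; exact: integrable_I.
under [LHS]eq_Rintegral do rewrite cImM.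
rewrite RintegralD //; [|exact/integrable_I/cZ|exact/integrable_I/cZ].
by rewrite !RintegralZl //; try exact: integrable_I; rewrite addrC.
Qed.

Lemma cint_pder f g : pder f g -> pcont g -> cint g = f (2 * pi) - f 0.
Proof.
move=> H [g1 g2].
have key (a b : R -> R) : (forall t, is_derive t (1 : R) a (b t)) -> continuous b ->
   (\int[mu]_(t in I) b t)%R = a (2 * pi) - a 0.
  move=> Ha cb.
  have ca : continuous a.
    by move=> t; have [h1 _] := Ha t; apply/differentiable_continuous/derivable1_diffP.
  have pi0 : (0 : R) < 2 * pi by rewrite mulr_gt0 ?pi_gt0.
  rewrite /Rintegral (@continuous_FTC2 _ b a) //; first exact: continuous_subspaceT.
    split=> [x _||]; first by have [] := Ha x.
      exact: cvg_at_right_filter (ca _).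
    exact: cvg_at_left_filter (ca _).
  by move=> x _; rewrite derive1E; have [_ ->] := Ha x.
apply: complex_ext; rewrite !ReImE !(Re_cint, Im_cint).
  by apply: (key (fun t => complex.Re (f t))) => // t; have [] := H t.
by apply: (key (fun t => complex.Im (f t))) => // t; have [] := H t.
Qed.

Definition cmass f : R := \int[mu]_(t in I) (`|complex.Re (f t)| + `|complex.Im (f t)|).

Lemma cint_bound f g (c : R) : pcont f -> pcont g -> 0 <= c ->
  (forall t, `|f t| <= c%:C * `|g t|) ->
  `|cint f| <= (c * cmass g *+ 2)%:C.
Proof.
move=> [f1 f2] [g1 g2] c0 H.
pose G t := `|complex.Re (g t)| + `|complex.Im (g t)|.
have cG : continuous G.
  move=> t; apply: (@continuousD _ _ _ (fun t => `|complex.Re (g t)|) (fun t => `|complex.Im (g t)|)).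
    by apply: continuous_comp; [exact: g1 | exact: norm_continuous].
  by apply: continuous_comp; [exact: g2 | exact: norm_continuous].
have cZG : continuous (fun t => c * G t).
  by move=> t; apply: continuousM; [exact: cst_continuous | exact: cG].
have key (a : R -> R) : continuous a -> (forall t, `|a t| <= c * G t) ->
    `|\int[mu]_(t in I) a t| <= c * cmass g.
  move=> ca Ha; apply: le_trans (le_normr_Rintegral _ _) _ => //; first exact: integrable_I.
  rewrite /cmass -RintegralZl //; last exact: integrable_I.
  apply: le_Rintegral => //; last exact: integrable_I.
  by apply: integrable_I => t; apply: continuous_comp; [exact: ca | exact: norm_continuous].
have HG t : `|f t| <= (c * G t)%:C.
  by apply: le_trans (H t) _; rewrite rmorphM ler_wpM2l ?ler0c // normC_leD.
apply: le_trans (normC_leD _) _; rewrite lecR /= mulr2n; apply: lerD; apply: key => // t.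
  by rewrite -lecR; apply: le_trans (HG t); exact: norm_ReC.
by rewrite -lecR; apply: le_trans (HG t); exact: norm_ImC.
Qed.

(** Differentiation under the integral sign: the Taylor estimate is uniform along
    the path, which stays in the disc of radius [B]. *)
Lemma qdiff_cint (ga ga' f f' : R -> C) (B : R) (u : C) :
  pder ga ga' -> pder f f' -> (forall t, `|ga t| <= B%:C) ->
  qdiff (fun v => cint (fun t => cexp (v * ga t) * f t)) u
    (cint (fun t => cexp (u * ga t) * (ga t * f t))).
Proof.
move=> Hga Hf HB.
have B0 : 0 <= B by rewrite -ler0c; apply: le_trans (HB 0).
have [K HK] := cexp_taylor B 2.
have cv (v : C) (h h' : R -> C) : pder h h' -> exists k, pder (fun t => cexp (v * ga t) * h t) k.
  move=> Hh; have Hv := pder_cexp (pderM (pder_cst v) Hga).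
  by eexists; exact: pderM Hv Hh.
have [k1 H1] := cv u _ _ Hf; have [k2 H2] := cv u _ _ (pderM Hga Hf).
apply: (@qdiff_bound _ _ _ _ (`|K| * B ^+ 2 * cmass (fun t => cexp (u * ga t) * f t) *+ 2)%:C) => h h1.
have [k3 H3] := cv (u + h) _ _ Hf.
have [r rE] := norm_realP h.
have H4 := pderM (pder_cst (-1)) H1; have H5 := pderM (pder_cst (- h)) H2.
have aux (x y w : C) : x - y - w * h = x + -1 * y + - h * w by ring.
rewrite aux.
rewrite -(cintZ _ (pder_cont H1)) -(cintZ _ (pder_cont H2)).
rewrite -(cintD (pder_cont H3) (pder_cont H4)) -(cintD (pder_cont (pderD H3 H4)) (pder_cont H5)).
set g := (fun t => cexp (u * ga t) * f t) in H1 *.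
have -> : (`|K| * B ^+ 2 * cmass g *+ 2)%:C * `|h| ^+ 2 =
    (`|K| * B ^+ 2 * r ^+ 2 * cmass g *+ 2)%:C.
  by rewrite rE -rmorphXn -rmorphM; congr (_%:C); ring.
apply: cint_bound.
- exact: pder_cont (pderD (pderD H3 H4) H5).
- exact: pder_cont H1.
- by apply: mulr_ge0; [apply: mulr_ge0|]; rewrite ?sqr_ge0.
move=> t.
have -> : cexp ((u + h) * ga t) * f t + -1 * (cexp (u * ga t) * f t)
    + - h * (cexp (u * ga t) * (ga t * f t)) =
    (cexp (h * ga t) - (texp R 2).[h * ga t]) * (cexp (u * ga t) * f t).
  by rewrite texp2E [(u + h) * _]mulrDl cexpD; ring.
rewrite [X in X <= _]normrM ler_wpM2r //.
have hg : `|h * ga t| <= B%:C.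
  by rewrite normrM; apply: le_trans (HB t); rewrite ler_piMl.
apply: le_trans (HK _ hg) _.
have -> : (`|K| * B ^+ 2 * r ^+ 2)%:C = `|K|%:C * (B%:C * r%:C) ^+ 2.
  by rewrite -rmorphM -rmorphXn -rmorphM; congr (_%:C); ring.
apply: le_trans (_ : `|K|%:C * `|h * ga t| ^+ 2 <= _).
  by rewrite ler_wpM2r ?exprn_ge0 // lecR ler_norm.
have r0 : 0 <= r%:C by rewrite -rE.
have Br0 : 0 <= B%:C * r%:C by apply: mulr_ge0 => //; rewrite ler0c.
rewrite ler_wpM2l ?ler0c // lerXn2r ?nnegrE //.
by rewrite normrM rE mulrC ler_wpM2r.
Qed.

End ContourIntegral.

(** * The differential equation of the dual functions *)

Section Dual.
Variable R : realType.
Local Notation C := R[i].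

(** The operator of the dual equation, written with the position [x] in place of [d/du]. *)
Definition dual_symbol (l z : C * C) (m : nat * nat) (a b u x : C) : C :=
  (x - z.1) * (x - z.2) * (u - l.1) * (u - l.2)
  - u * (m.1%:R * (x - z.2) + m.2%:R * (x - z.1))
  + a * (x - z.1) + b * (x - z.2).

Lemma tw_ode_horner (F : numFieldType) (l z : F * F) (m : nat * nat) (a b l0 : F) p x :
  tw_ode l z m a b l0 p ->
  (x - z.1) * (x - z.2) * (twD l0 (twD l0 p)).[x]
  - ((l.1 + l.2) * ((x - z.1) * (x - z.2)) + m.1%:R * (x - z.2) + m.2%:R * (x - z.1))
    * (twD l0 p).[x]
  + ((l.1 * l.2) * ((x - z.1) * (x - z.2)) + a * (x - z.1) + b * (x - z.2)) * p.[x] = 0.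
Proof.
move/(congr1 (fun q => q.[x])); rewrite horner0.
move: (twD l0 p) => p1 <-.
by rewrite !(hornerD, hornerN, hornerM, hornerZ, hornerXsubC, hornerX) -!polyC_natr !hornerC.
Qed.

(** With [f = p e^{l0 x}] and [s = l_1 + l_2], the function
    [e^{(u - s) x} (u f - f') X^{-m_1} Y^{-m_2}] is a primitive of
    [e^{ux} phi(x)] times the symbol, where [phi = e^{-s x} f X^{-m_1-1} Y^{-m_2-1}].
    It is the boundary term of two integrations by parts, and the equation of [f]
    eliminates [f'']. *)
Lemma pder_dual (l z : C * C) (m : nat * nat) (a b l0 u : C) (p : {poly C})
    (ga ga' : R -> C) :
  tw_ode l z m a b l0 p -> pder ga ga' ->
  (forall t, ga t - z.1 != 0) -> (forall t, ga t - z.2 != 0) ->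
  pder (fun t => cexp ((u - (l.1 + l.2) + l0) * ga t) * (u *: p - twD l0 p).[ga t]
          * ((ga t - z.1)^-1 ^+ m.1 * (ga t - z.2)^-1 ^+ m.2))
   (fun t => cexp (u * ga t) * (cexp ((l0 - (l.1 + l.2)) * ga t) * p.[ga t]
          * ((ga t - z.1)^-1 ^+ m.1.+1 * (ga t - z.2)^-1 ^+ m.2.+1) * ga' t)
     * dual_symbol l z m a b u (ga t)).
Proof.
move=> ode H X0 Y0.
have HX := pderX m.1 (pderV (pderD H (pder_cst (- z.1))) X0).
have HY := pderX m.2 (pderV (pderD H (pder_cst (- z.2))) Y0).
set s := l.1 + l.2.
have HE := pder_cexp (pderM (pder_cst (u - s + l0)) H).
have Hr := pder_horner (u *: p - twD l0 p) H.
apply: pder_eq (pderM (pderM HE Hr) (pderM HX HY)) _ => t.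
have {}X0 := X0 t; have {}Y0 := Y0 t.
have EE : cexp ((u - s + l0) * ga t) = cexp (u * ga t) * cexp ((l0 - s) * ga t) :> C.
  by rewrite -cexpD; congr cexp; ring.
(* For exponent 0 both sides vanish, whatever the predecessor of 0 is. *)
have XV : m.1%:R * (ga t - z.1)^-1 ^+ m.1.-1 * (ga t - z.1)^-1 ^+ 2 =
    m.1%:R * (ga t - z.1)^-1 ^+ m.1.+1.
  by case: (m.1) => [|k] /=; rewrite ?mul0r // -mulrA -exprD addn2.
have YV : m.2%:R * (ga t - z.2)^-1 ^+ m.2.-1 * (ga t - z.2)^-1 ^+ 2 =
    m.2%:R * (ga t - z.2)^-1 ^+ m.2.+1.
  by case: (m.2) => [|k] /=; rewrite ?mul0r // -mulrA -exprD addn2.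
set x := ga t in X0 Y0 EE XV YV *; set g := ga' t.
pose P := p.[x]; pose P1 := (twD l0 p).[x]; pose P2 := (twD l0 (twD l0 p)).[x].
have dE q : q^`().[x] = (twD l0 q).[x] - l0 * q.[x].
  by rewrite /twD hornerD hornerZ addrK.
have rx : (u *: p - twD l0 p).[x] = u * P - P1.
  by rewrite hornerD hornerN hornerZ.
have rx' : (u *: p - twD l0 p)^`().[x] = u * (P1 - l0 * P) - (P2 - l0 * P1).
  by rewrite derivB derivZ hornerD hornerN hornerZ !dE.
have odex : ((l.1 * l.2) * ((x - z.1) * (x - z.2)) + a * (x - z.1) + b * (x - z.2)) * P =
    (s * ((x - z.1) * (x - z.2)) + m.1%:R * (x - z.2) + m.2%:R * (x - z.1)) * P1
    - (x - z.1) * (x - z.2) * P2.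
  have E := tw_ode_horner x ode; rewrite -/P -/P1 -/P2 in E.
  apply/eqP; rewrite -subr_eq0; apply/eqP; rewrite -[RHS]E /s; ring.
rewrite rx rx' EE.
transitivity (cexp (u * x) * cexp ((l0 - s) * x) * g
   * (x - z.1)^-1 ^+ m.1.+1 * (x - z.2)^-1 ^+ m.2.+1 *
   ((x - z.1) * (x - z.2) * ((u - s) * (u * P - P1) + u * P1 - P2)
     - (m.1%:R * (x - z.2) + m.2%:R * (x - z.1)) * (u * P - P1))).
  have RX : m.1%:R * (x - z.1)^-1 ^+ m.1.-1 * - ((g + 0) * (x - z.1)^-1 ^+ 2)
      = - g * (m.1%:R * (x - z.1)^-1 ^+ m.1.+1) by rewrite -XV; ring.
  have RY : m.2%:R * (x - z.2)^-1 ^+ m.2.-1 * - ((g + 0) * (x - z.2)^-1 ^+ 2)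
      = - g * (m.2%:R * (x - z.2)^-1 ^+ m.2.+1) by rewrite -YV; ring.
  rewrite RX RY !exprS; move: (_ ^+ m.1) (_ ^+ m.2) => al be.
  by field; rewrite X0 Y0.
transitivity (cexp (u * x) * cexp ((l0 - s) * x) * g
   * (x - z.1)^-1 ^+ m.1.+1 * (x - z.2)^-1 ^+ m.2.+1 *
   ((x - z.1) * (x - z.2) * (u * u - s * u) * P - u * (m.1%:R * (x - z.2) + m.2%:R * (x - z.1)) * P
    + ((l.1 * l.2) * ((x - z.1) * (x - z.2)) + a * (x - z.1) + b * (x - z.2)) * P)).
  by rewrite odex; ring.
by rewrite /dual_symbol /s /P; ring.
Qed.

Definition smooth (f : R -> C) := exists f', pder f f'.

Lemma smoothM (f g : R -> C) : smooth f -> smooth g -> smooth (fun t => f t * g t).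
Proof. by move=> [f' Hf] [g' Hg]; eexists; exact: pderM Hf Hg. Qed.
Lemma smoothD (f g : R -> C) : smooth f -> smooth g -> smooth (fun t => f t + g t).
Proof. by move=> [f' Hf] [g' Hg]; eexists; exact: pderD Hf Hg. Qed.
Lemma smooth_cst c : smooth (fun=> c).
Proof. by eexists; exact: pder_cst. Qed.
Lemma smoothX n (f : R -> C) : smooth f -> smooth (fun t => f t ^+ n).
Proof. by move=> [f' Hf]; eexists; exact: pderX Hf. Qed.
Lemma smoothV (f : R -> C) : smooth f -> (forall t, f t != 0) -> smooth (fun t => (f t)^-1).
Proof. by move=> [f' Hf] f0; eexists; exact: pderV Hf f0. Qed.
Lemma smooth_cexp (f : R -> C) : smooth f -> smooth (fun t => cexp (f t)).
Proof. by move=> [f' Hf]; eexists; exact: pder_cexp Hf. Qed.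
Lemma smooth_horner (p : {poly C}) (f : R -> C) : smooth f -> smooth (fun t => p.[f t]).
Proof. by move=> [f' Hf]; eexists; exact: pder_horner Hf. Qed.
Lemma smooth_cont (f : R -> C) : smooth f -> pcont f.
Proof. by move=> [f' Hf]; exact: pder_cont Hf. Qed.

Section Circle.
Variables (za : C) (r : R).

Definition circ (t : R) : C := za + r%:C * cexp (0 +i* t).
Definition circ' (t : R) : C := (0 +i* r) * cexp (0 +i* t).

Lemma pder_circ : pder circ circ'.
Proof.
have Hi : pder (fun t : R => 0 +i* t) (fun=> 'i).
  by move=> t; split; [exact: is_derive_cst | exact: is_derive_id].
apply: pder_eq (pderD (pder_cst za) (pderM (pder_cst r%:C) (pder_cexp Hi))) _ => t.
rewrite /circ' mul0r !add0r mulrA; congr (_ * _).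
by apply: complex_ext; rewrite !ReImE /=; ring.
Qed.

Lemma smooth_circ : smooth circ. Proof. by eexists; exact: pder_circ. Qed.

Lemma smooth_circ' : smooth circ'.
Proof.
apply: smoothM (smooth_cst _) _; apply: smooth_cexp; exists (fun=> 'i) => t.
by split; [exact: is_derive_cst | exact: is_derive_id].
Qed.

Lemma circ_closed : circ (2 * pi) = circ 0.
Proof.
rewrite /circ; congr (_ + _ * _); rewrite /cexp /= mulr_natl cos2pi sin2pi.
by rewrite cos0 sin0.
Qed.

Lemma norm_circ0 t : 0 < r -> `|r%:C * cexp (0 +i* t)| = r%:C.
Proof.
move=> r0; rewrite normrM norm_cexp /= expR0 mulr1 normC_real.
by rewrite gtr0_norm.
Qed.

Lemma norm_circ : 0 < r -> exists B : R, forall t, `|circ t| <= B%:C.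
Proof.
move=> r0; exists (Num.sqrt (complex.Re za ^+ 2 + complex.Im za ^+ 2) + r) => t.
apply: le_trans (ler_normD _ _) _; rewrite norm_circ0 //.
by rewrite normc_def -rmorphD.
Qed.

Lemma circ_neq w : 0 < r -> w = za \/ r%:C < `|za - w| -> forall t, circ t - w != 0.
Proof.
move=> r0 Hw t; apply/eqP => E.
have H : r%:C * cexp (0 +i* t) = w - za.
  by apply/eqP; rewrite -subr_eq0; apply/eqP; rewrite -[RHS]E /circ; ring.
have := norm_circ0 t r0; rewrite H; case: Hw => [->|Hw].
  by rewrite subrr normr0 => -[] E0; move: r0; rewrite -E0 ltxx.
by rewrite distrC => E0; move: Hw; rewrite E0 ltxx.
Qed.

End Circle.

(** The contour integral of [e^{ux} phi(x)] times [dual_symbol] is that of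
    a derivative along a closed path, hence zero; expanding the symbol in powers of
    [x], each factor [x] is a derivative in [u]. *)
Lemma dual_ode (l z : C * C) (m : nat * nat) (a b : C) (p1 p2 : {poly C})
    (A B K za : C) (r : R) (g : C -> C) :
  tw_ode l z m a b l.1 p1 -> tw_ode l z m a b l.2 p2 -> 0 < r ->
  z.1 = za \/ r%:C < `|za - z.1| -> z.2 = za \/ r%:C < `|za - z.2| ->
  let phi x := K * (A * (p1.[x] * cexp ((l.1 - (l.1 + l.2)) * x))
     + B * (p2.[x] * cexp ((l.2 - (l.1 + l.2)) * x)))
     * ((x - z.1)^-1 ^+ m.1.+1 * (x - z.2)^-1 ^+ m.2.+1) in
  (forall u, g u = circle_integral za r (fun x => cexp (u * x) * phi x)) ->
  exists g1 g2 : C -> C, [/\ forall u, qdiff g u (g1 u), forall u, qdiff g1 u (g2 u) &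
   forall u, (u - l.1) * (u - l.2) * (g2 u - (z.1 + z.2) * g1 u + z.1 * z.2 * g u)
     - u * (m.1%:R * (g1 u - z.2 * g u) + m.2%:R * (g1 u - z.1 * g u))
     + a * (g1 u - z.1 * g u) + b * (g1 u - z.2 * g u) = 0].
Proof.
move=> o1 o2 r0 h1 h2 phi gE.
have n1 := circ_neq r0 h1; have n2 := circ_neq r0 h2.
set ga := circ za r in n1 n2; set ga' := circ' r.
have Hga : pder ga ga' := pder_circ za r.
have sga : smooth ga := smooth_circ za r.
have [Bd HBd] := norm_circ za r0.
pose F t := phi (ga t) * ga' t.
have sF : smooth F.
  apply: smoothM (smooth_circ' r).
  have sV w (n : nat) : (forall t, ga t - w != 0) -> smooth (fun t => (ga t - w)^-1 ^+ n).
    by move=> nw; apply: smoothX; apply: smoothV nw; apply: smoothD sga (smooth_cst _).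
  apply: smoothM (smoothM (sV _ _ n1) (sV _ _ n2)).
  apply: smoothM (smooth_cst _) _; apply: smoothD; apply: smoothM (smooth_cst _) _;
    by apply: smoothM (smooth_horner _ sga) _; apply: smooth_cexp; apply: smoothM (smooth_cst _) sga.
pose J k u := cint (fun t => cexp (u * ga t) * (ga t ^+ k * F t)).
have sJ k : smooth (fun t => ga t ^+ k * F t) by apply: smoothM (smoothX _ sga) sF.
have qJ k u : qdiff (J k) u (J k.+1 u).
  have [F' HF'] := sJ k.
  apply: qdiff_eq (qdiff_cint u Hga HF' HBd) _; rewrite /J; congr cint.
  by apply: funext => t; rewrite exprS !mulrA.
have gJ u : g u = J 0%N u.
  rewrite gE /circle_integral /J /cint -/ga.
  have E t : cexp (u * ga t) * phi (ga t) * ga' t = cexp (u * ga t) * (ga t ^+ 0 * F t).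
    by rewrite expr0 mul1r /F mulrA.
  by congr (_ +i* _); apply: eq_Rintegral => t _; rewrite -E.
exists (J 1%N), (J 2%N); split=> [u|u|u].
- by rewrite (_ : g = J 0%N) //; apply: funext.
- exact: qJ.
rewrite gJ.
have sE k : smooth (fun t => cexp (u * ga t) * (ga t ^+ k * F t)).
  by apply: smoothM (sJ k); apply: smooth_cexp; apply: smoothM (smooth_cst _) sga.
have cJ k c : c * J k u = cint (fun t => c * (cexp (u * ga t) * (ga t ^+ k * F t))).
  by rewrite cintZ //; exact/smooth_cont.
pose c2 := (u - l.1) * (u - l.2).
pose c1 := - c2 * (z.1 + z.2) - u * (m.1%:R + m.2%:R) + a + b.
pose c0 := c2 * (z.1 * z.2) + u * (m.1%:R * z.2 + m.2%:R * z.1) - a * z.1 - b * z.2.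
transitivity (c2 * J 2%N u + c1 * J 1%N u + c0 * J 0%N u).
  by rewrite /c1 /c0 /c2; ring.
have sZ c k : pcont (fun t => c * (cexp (u * ga t) * (ga t ^+ k * F t))).
  by apply: smooth_cont; apply: smoothM (smooth_cst _) (sE k).
have sZ2 : pcont (fun t => c2 * (cexp (u * ga t) * (ga t ^+ 2 * F t))
    + c1 * (cexp (u * ga t) * (ga t ^+ 1 * F t))).
  by apply: smooth_cont; apply: smoothD; apply: smoothM (smooth_cst _) (sE _).
rewrite !cJ -cintD // -cintD //.
have D1 := pder_dual u o1 Hga n1 n2; have D2 := pder_dual u o2 Hga n1 n2.
have D := pderM (pder_cst K) (pderD (pderM (pder_cst A) D1) (pderM (pder_cst B) D2)).
set h := (X in cint X).
have {}D := pder_eq D (_ : _ =1 h).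
rewrite (cint_pder (D _)); last 1 first.
- apply: smooth_cont; rewrite /h; apply: smoothD; last exact: smoothM (smooth_cst _) (sE _).
  by apply: smoothD; apply: smoothM (smooth_cst _) (sE _).
- by rewrite /ga circ_closed subrr.
move=> t; rewrite /h /F /phi /dual_symbol /c0 /c1 /c2 expr0 expr1; cbv beta.
set E1 := cexp (u * ga t); set E2 := cexp ((l.1 - _) * _); set E3 := cexp ((l.2 - _) * _).
set X1 := _ ^+ m.1.+1; set Y1 := _ ^+ m.2.+1.
by ring.
Qed.

End Dual.

(** * Comparison of the accessory parameters *)

Lemma natr_complement (F : numFieldType) (n m : nat * nat) : (n.1 + n.2 = m.1 + m.2)%N ->
  n.1%:R = m.1%:R + m.2%:R - n.2%:R :> F.
Proof. by move=> nm; rewrite -natrD -nm natrD addrK. Qed.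

Section Link.
Variable R : realType.
Local Notation C := R[i].

Lemma mem_cspan (S : set (C -> C)) f : S f -> cspan S f.
Proof.
move=> Sf; exists 1%N, (fun=> 1), (fun=> f); split=> //.
by apply: funext => x; rewrite big_ord1 mul1r.
Qed.

Lemma cspan_neq0 (S : set (C -> C)) f x : cspan S f -> f x != 0 ->
  exists2 g, S g & g x != 0.
Proof.
move=> [d [a [k [Hk ->]]]] nz; apply/not_exists2P => H; case/eqP: nz.
rewrite big1 // => i _; case: (H (k i)) => [//|/negP].
by rewrite negbK => /eqP ->; rewrite mulr0.
Qed.

(** A nonzero polynomial has fewer roots than its size among [0, 1, 2, ...]. *)
Lemma poly_nonvanish (p : {poly C}) : p != 0 -> exists x, p.[x] != 0.
Proof.
move=> p0; apply/not_existsP => H; case/eqP: p0.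
apply: (@roots_geq_poly_eq0 _ _ [seq i%:R | i <- iota 0 (size p)]).
- by apply/allP => x _; have /negP := H x; rewrite negbK.
- by rewrite map_inj_uniq ?iota_uniq // => i j /eqP; rewrite eqr_nat => /eqP.
- by rewrite size_map size_iota.
Qed.

(** A circle around [z_1] or [z_2] of radius less than [|z_1 - z_2|] meets neither
    point, and the Wronskian of any basis is a constant times
    [e^{(l_1 + l_2) x} X^{m_1} Y^{m_2}], which gives the integrand of [dual_ode]. *)
Lemma generator_ode (l z : C * C) (m : nat * nat) (a b C0 : C) (p1 p2 : {poly C})
    (g : C -> C) (za : C) (f : C -> C) :
  z.1 != z.2 ->
  twWr l p1 p2 = C0 *: (('X - z.1%:P) ^+ m.1 * ('X - z.2%:P) ^+ m.2) ->
  tw_ode l z m a b l.1 p1 -> tw_ode l z m a b l.2 p2 ->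
  za = z.1 \/ za = z.2 ->
  star_space (cspan [set quasi_exp p1 l.1; quasi_exp p2 l.2]) f ->
  (\forall r \near (0 : R)^'+, forall u : C, g u = circle_integral za r
      (fun x => cexp (u * x) * f x * (x - z.1)^-1 * (x - z.2)^-1)) ->
  exists g1 g2 : C -> C, [/\ forall u, qdiff g u (g1 u), forall u, qdiff g1 u (g2 u) &
   forall u, (u - l.1) * (u - l.2) * (g2 u - (z.1 + z.2) * g1 u + z.1 * z.2 * g u)
     - u * (m.1%:R * (g1 u - z.2 * g u) + m.2%:R * (g1 u - z.1 * g u))
     + a * (g1 u - z.1 * g u) + b * (g1 u - z.2 * g u) = 0].
Proof.
move=> z12 WE o1 o2 zaE [f1 [f2 [f0 [[VE _] Vf fE]]]] Hr.
have [rho rhoE] := norm_realP (z.1 - z.2).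
have rho0 : 0 < rho by rewrite -ltcR -rhoE normr_gt0 subr_eq0.
have [r [[r0 rr] {}Hr]] := filter_ex (filterI (filterI (nbhs_right_gt 0) (nbhs_right_lt rho0)) Hr).
have [A0 [B0 f0E]] : exists A0 B0, f0 = fun x => A0 * quasi_exp p1 l.1 x + B0 * quasi_exp p2 l.2 x.
  exact/cspan_pairP.
have [A1 [B1 f1E]] : exists A0 B0, f1 = fun x => A0 * quasi_exp p1 l.1 x + B0 * quasi_exp p2 l.2 x.
  by apply/cspan_pairP; rewrite VE; apply/cspan_pairP; exists 1, 0;
     apply: funext => x; rewrite mul1r mul0r addr0.
have [A2 [B2 f2E]] : exists A0 B0, f2 = fun x => A0 * quasi_exp p1 l.1 x + B0 * quasi_exp p2 l.2 x.
  by apply/cspan_pairP; rewrite VE; apply/cspan_pairP; exists 0, 1;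
     apply: funext => x; rewrite mul1r mul0r add0r.
apply: (@dual_ode _ l z m a b p1 p2 A0 B0 ((A1 * B2 - B1 * A2) * C0)^-1 za r) => //.
- case: zaE => ->; [by left|right].
  by rewrite distrC rhoE ltcR.
- case: zaE => ->; [right|by left].
  by rewrite rhoE ltcR.
move=> u; rewrite Hr; congr circle_integral; apply: funext => x.
rewrite fE f1E f2E wronskian_comb WE f0E /quasi_exp; cbv beta.
have Ei i : cexp ((i - (l.1 + l.2)) * x) = cexp (i * x) * (cexp ((l.1 + l.2) * x))^-1 :> C.
  rewrite mulrBl cexpD; congr (_ * _); apply: (mulfI (cexp_neq0 ((l.1 + l.2) * x))).
  by rewrite -cexpD subrr cexp0 mulfV // cexp_neq0.
rewrite !Ei hornerZ hornerM !horner_exp !hornerXsubC.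
move: (cexp (u * x)) (cexp (l.1 * x)) (cexp (l.2 * x)) (cexp ((l.1 + l.2) * x)) => e0 e1 e2 e3.
by rewrite !invfM !exprVn !exprS !invfM; ring.
Qed.

(** The two second order equations for [g] agree except for a constant in
    the coefficient of [g]: the relations on [a + b] and [au + bu] match the
    coefficient of [g'] and the linear term in the coefficient of [g]. *)
Lemma eigenvalue_link (l z : C * C) (n m : nat * nat) (a b au bu A B : C) (q1 q2 : {poly C})
    (g g1 g2 : C -> C) (u : C) :
  (n.1 + n.2 = m.1 + m.2)%N ->
  a + b = l.2 * (m.1 + m.2)%:R - (l.2 - l.1) * n.2%:R ->
  au + bu = z.2 * (n.1 + n.2)%:R - (z.2 - z.1) * m.2%:R ->
  tw_ode z l n au bu z.1 q1 -> tw_ode z l n au bu z.2 q2 ->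
  (forall v, g v = A * quasi_exp q1 z.1 v + B * quasi_exp q2 z.2 v) ->
  (forall v, qdiff g v (g1 v)) -> (forall v, qdiff g1 v (g2 v)) ->
  (u - l.1) * (u - l.2) * (g2 u - (z.1 + z.2) * g1 u + z.1 * z.2 * g u)
     - u * (m.1%:R * (g1 u - z.2 * g u) + m.2%:R * (g1 u - z.1 * g u))
     + a * (g1 u - z.1 * g u) + b * (g1 u - z.2 * g u) = 0 ->
  g u != 0 -> a * z.1 + b * z.2 = au * l.1 + bu * l.2.
Proof.
move=> nm abE abuE o1 o2 gE dg dg1 E gu.
have g1E v : g1 v = A * quasi_exp (twD z.1 q1) z.1 v + B * quasi_exp (twD z.2 q2) z.2 v.
  apply: qdiff_uniq (dg v) _; have -> : g = fun v => A * quasi_exp q1 z.1 v + B * quasi_exp q2 z.2 v.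
    exact/funext.
  exact: qdiff_comb.
have g2E v : g2 v = A * quasi_exp (twD z.1 (twD z.1 q1)) z.1 v
    + B * quasi_exp (twD z.2 (twD z.2 q2)) z.2 v.
  apply: qdiff_uniq (dg1 v) _.
  have -> : g1 = fun v => A * quasi_exp (twD z.1 q1) z.1 v + B * quasi_exp (twD z.2 q2) z.2 v.
    exact/funext.
  exact: qdiff_comb.
have O : (u - l.1) * (u - l.2) * g2 u - ((z.1 + z.2) * ((u - l.1) * (u - l.2))
    + n.1%:R * (u - l.2) + n.2%:R * (u - l.1)) * g1 u
    + ((z.1 * z.2) * ((u - l.1) * (u - l.2)) + au * (u - l.1) + bu * (u - l.2)) * g u = 0.
  have O1 := tw_ode_horner u o1; have O2 := tw_ode_horner u o2.
  rewrite g2E g1E gE /quasi_exp.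
  transitivity (A * cexp (z.1 * u) * 0 + B * cexp (z.2 * u) * 0 : C); last by rewrite !mulr0 addr0.
  by rewrite -{1}O1 -O2; ring.
apply/eqP; rewrite -subr_eq0; apply/eqP; apply: (mulIf gu); rewrite mul0r.
have n1E := natr_complement C nm.
have aE : a = l.2 * (m.1 + m.2)%:R - (l.2 - l.1) * n.2%:R - b by rewrite -abE addrK.
have auE : au = z.2 * (n.1 + n.2)%:R - (z.2 - z.1) * m.2%:R - bu by rewrite -abuE addrK.
transitivity (((u - l.1) * (u - l.2) * g2 u - ((z.1 + z.2) * ((u - l.1) * (u - l.2))
    + n.1%:R * (u - l.2) + n.2%:R * (u - l.1)) * g1 u
    + ((z.1 * z.2) * ((u - l.1) * (u - l.2)) + au * (u - l.1) + bu * (u - l.2)) * g u)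
  - ((u - l.1) * (u - l.2) * (g2 u - (z.1 + z.2) * g1 u + z.1 * z.2 * g u)
     - u * (m.1%:R * (g1 u - z.2 * g u) + m.2%:R * (g1 u - z.1 * g u))
     + a * (g1 u - z.1 * g u) + b * (g1 u - z.2 * g u))).
  by rewrite aE auE !natrD n1E; ring.
by rewrite O E subrr.
Qed.

(** Both equations apply to a generator [g] of [U] that does not vanish
    identically; there is one because [q2 e^{z_2 u}] is in the span of the generators. *)
Lemma dual_eigenvalue (l z : C * C) (n m : nat * nat) (V U : set (C -> C))
    (p1 p2 q1 q2 : {poly C}) (a b au bu C0 : C) :
  (n.1 + n.2 = m.1 + m.2)%N -> z.1 != z.2 ->
  V = cspan [set quasi_exp p1 l.1; quasi_exp p2 l.2] ->
  U = cspan [set quasi_exp q1 z.1; quasi_exp q2 z.2] ->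
  U = bispectral_dual z V -> q2 != 0 ->
  twWr l p1 p2 = C0 *: (('X - z.1%:P) ^+ m.1 * ('X - z.2%:P) ^+ m.2) ->
  tw_ode l z m a b l.1 p1 -> tw_ode l z m a b l.2 p2 ->
  tw_ode z l n au bu z.1 q1 -> tw_ode z l n au bu z.2 q2 ->
  a + b = l.2 * (m.1 + m.2)%:R - (l.2 - l.1) * n.2%:R ->
  au + bu = z.2 * (n.1 + n.2)%:R - (z.2 - z.1) * m.2%:R ->
  a * z.1 + b * z.2 = au * l.1 + bu * l.2.
Proof.
move=> nm z12 VE UE Ud q20 WE o1 o2 r1 r2 abE abuE.
have [u qu] := poly_nonvanish q20.
have Uq : U (quasi_exp q2 z.2) by rewrite UE; apply: mem_cspan; right.
have qu0 : quasi_exp q2 z.2 u != 0 by rewrite /quasi_exp mulf_neq0 // cexp_neq0.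
have Uq' := Uq; rewrite Ud in Uq'.
have [g Sg gu] := cspan_neq0 Uq' qu0.
have Ug : U g by rewrite Ud; apply: mem_cspan.
move: Ug; rewrite UE => /cspan_pairP [A [B gE]].
case: Sg => za [f [zaE Vf Hr]]; rewrite VE in Vf.
have [g1 [g2 [dg dg1 E]]] := generator_ode z12 WE o1 o2 zaE Vf Hr.
apply: (eigenvalue_link nm abE abuE r1 r2 (g := g) (A := A) (B := B) _ dg dg1 (E u) gu).
by move=> v; rewrite gE.
Qed.

End Link.

(** * Proportionality of the Bethe vectors *)

Section Transport.
Variable F : numFieldType.

(** [d] comes from [p_1], whose recurrence is that of [p_2] with the indices 1 and 2
    of [n] and of [lambda] exchanged, so that [h] becomes [- h].  As
    [n_1 - (m_2 - i) = m_1 - n_2 + i], reading it backwards gives the same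
    off-diagonal entries. *)
Lemma tridiag_reverse (n m : nat * nat) (h h0 h1 : F) (d : nat -> F) i :
  (n.1 + n.2 = m.1 + m.2)%N -> (i <= n.2)%N -> (i <= m.2)%N -> (m.2 - i <= n.1)%N ->
  tridiag n.1 m (- h) d (m.2 - i) = h1 * d (m.2 - i)%N ->
  h1 = h0 + h * m.1%:R ->
  tridiag n.2 m h (fun i => d (m.2 - i)%N) i = h0 * d (m.2 - i)%N.
Proof.
move=> nm im2 im in1 E h1E.
have n1E := natr_complement F nm.
have h0E : h0 = h1 - h * m.1%:R by rewrite h1E addrK.
rewrite h0E mulrBl -E /tridiag -subnS !natrB // n1E.
case: i im2 im in1 E => [|i] im2 im in1 E.
  by rewrite subn0; ring.
have -> : (m.2 - i.+1).+1 = (m.2 - i)%N by lia.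
by rewrite /=; ring.
Qed.

(** Exchanging [n] and [m] preserves the off-diagonal entries because
    [m_2 - n_1 = n_2 - m_1]; the diagonal entries change by a constant. *)
Lemma tridiag_dual (n m : nat * nat) (h h0 h1 : F) (e : nat -> F) i :
  (n.1 + n.2 = m.1 + m.2)%N -> (i <= n.2)%N -> (i <= m.2)%N ->
  tridiag m.2 n h e i = h1 * e i ->
  h0 = h1 + h * (m.2%:R - n.2%:R) ->
  tridiag n.2 m h e i = h0 * e i.
Proof.
move=> nm im2 im E h0E.
have n1E := natr_complement F nm.
by rewrite h0E mulrDl -E /tridiag !natrB // n1E; ring.
Qed.

Lemma basis_map_sum (vT wT : vectType F) k (X : k.-tuple vT) (Y : k.-tuple wT)
    (a b : nat) (c : nat -> F) (v : nat -> vT) :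
  basis_map X Y (\sum_(a <= i < b) c i *: v i) =
  \sum_(a <= i < b) c i *: basis_map X Y (v i).
Proof.
rewrite /basis_map; under eq_bigr do rewrite linear_sum scaler_suml.
rewrite exchange_big /=; apply: eq_bigr => i _; rewrite scaler_sumr.
by apply: eq_bigr => j _; rewrite linearZ /= scalerA.
Qed.

Lemma dependent_pair (vT : vectType F) (s t : F) (x y : vT) :
  (s, t) != (0, 0) -> s *: x + t *: y = 0 -> ~~ free [:: x; y].
Proof.
move=> st E; rewrite free_cons seq1_free; apply/negP => /andP[xy y0].
have [s0|s0] := eqVneq s 0.
  move: E st; rewrite s0 scale0r add0r => /eqP; rewrite scaler_eq0 (negbTE y0) orbF.
  by move=> /eqP ->; rewrite eqxx.
case/negP: xy; rewrite span_seq1; apply/vlineP; exists (- (s^-1 * t)).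
have := congr1 (fun v => s^-1 *: v) E; rewrite scaler0 scalerDr !scalerA mulVf // scale1r.
by move/eqP; rewrite addr_eq0 scaleNr => /eqP.
Qed.

Lemma dependent_sums (vT : vectType F) (a b : nat) (x y : nat -> F) (v : nat -> vT) (s t : F) :
  (s, t) != (0, 0) -> (forall i, (a <= i <= b)%N -> s * x i + t * y i = 0) ->
  ~~ free [:: \sum_(a <= i < b.+1) x i *: v i; \sum_(a <= i < b.+1) y i *: v i].
Proof.
move=> st H; apply: (dependent_pair st); rewrite !scaler_sumr -big_split /=.
rewrite big_nat big1 // => i; rewrite ltnS => /H E.
by rewrite !scalerA -scalerDl E scale0r.
Qed.

Lemma sum_reverse (V : zmodType) (a b m : nat) (f : nat -> V) : (a <= b)%N -> (b <= m)%N ->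
  \sum_(m - b <= j < (m - a).+1) f j = \sum_(a <= i < b.+1) f (m - i)%N.
Proof.
move=> ab bm; rewrite big_nat_rev /= -[(m - b)%N]add0n big_addn -[a]add0n [RHS]big_addn.
have -> : ((m - a).+1 - (m - b) = b.+1 - a)%N by lia.
by apply: eq_big_nat => i ib; congr f; lia.
Qed.

(** The Weyl image is again a basis vector of the target weight space, because
    [n_1 - (m_2 - i) = m_1 + i - n_2]. *)
Lemma weyl_wvec (n m : nat * nat) i : (n.1 + n.2 = m.1 + m.2)%N ->
  (alpha n m <= i <= beta n m)%N ->
  weyl n m (wvec m.1 m.2 n.2 i) = wvec m.1 m.2 n.1 (m.2 - i) :> 'M[F]_(_, _).
Proof.
move=> nm ib; rewrite weylE // /wvec; congr (tens (divpow _ _) _).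
by move: ib; rewrite /alpha /beta; lia.
Qed.

End Transport.

Lemma tw_ode_swap (F : numFieldType) (l z : F * F) m (a b : F) p :
  tw_ode l z m a b l.1 p -> tw_ode (l.2, l.1) z m a b (l.2, l.1).2 p.
Proof. by rewrite /tw_ode /= [l.2 + l.1]addrC [l.2 * l.1]mulrC. Qed.

Lemma two_point_polyP (R : realType) n (x y : R[i]) c p (P : {poly R[i]} -> Prop) :
  p = two_point_poly n x y c -> P p -> P (tpoly n x y c).
Proof. by move=> ->. Qed.

Theorem corollary6p4 (R : realType) (n m : nat * nat) (lam z : R[i] * R[i])
    (V U : set (R[i] -> R[i])) (p1 p2 q1 q2 : {poly R[i]})
    (c d e : nat -> R[i]) :
  (n.1 + n.2 = m.1 + m.2)%N ->
  lam.1 != lam.2 -> z.1 != z.2 ->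
  space_of_type lam z n m V ->
  quasi_exp_space lam n p1 p2 V ->
  U = bispectral_dual z V ->
  space_of_type z lam m n U ->
  quasi_exp_space z m q1 q2 U ->
  p2 = two_point_poly n.2 z.1 z.2 c ->
  p1 = two_point_poly n.1 z.1 z.2 d ->
  q2 = two_point_poly m.2 lam.1 lam.2 e ->
  let a := alpha n m in
  let b := beta n m in
  let w1 : 'M[R[i]]_(m.1.+1, m.2.+1) :=
    \sum_(a <= i < b.+1) c i *: wvec m.1 m.2 n.2 i in
  let w2 : 'M[R[i]]_(m.1.+1, m.2.+1) :=
    \sum_(m.2 - b <= j < (m.2 - a).+1) d j *: wvec m.1 m.2 n.1 j in
  let w3 : 'M[R[i]]_(n.1.+1, n.2.+1) :=
    \sum_(a <= i < b.+1) e i *: wvec n.1 n.2 m.2 i in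
  [/\ ~~ free [:: weyl n m w1; w2],
      ~~ free [:: duality n m w3; w1] &
      ~~ free [:: weyl n m (duality n m w3); w2]].
Proof.
move=> nm l12 z12 Vtype Vp Ud Utype Uq p2E p1E q2E al be w1 w2 w3.
have [[C0 WE] [a [b [V1 V2]]]] := space_ode nm l12 z12 Vtype Vp.
have [_ [a' [b' [r1 r2]]]] := space_ode (esym nm) z12 l12 Utype Uq.
have [s1 s2 VE] := Vp; have [_ t2 UE] := Uq.
have [abE Hc] := tw_ode_tridiag z12
  (two_point_polyP (P := fun p => size p = n.2.+1) p2E s2)
  (two_point_polyP (P := tw_ode lam z m a b lam.2) p2E V2).
have [_ Hd] := tw_ode_tridiag z12
  (two_point_polyP (P := fun p => size p = n.1.+1) p1E s1)
  (tw_ode_swap (two_point_polyP (P := tw_ode lam z m a b lam.1) p1E V1)).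
have [abuE He] := tw_ode_tridiag l12
  (two_point_polyP (P := fun p => size p = m.2.+1) q2E t2)
  (two_point_polyP (P := tw_ode z lam n a' b' z.2) q2E r2).
have q20 : q2 != 0 by rewrite -size_poly_gt0 t2.
have link := dual_eigenvalue nm z12 VE UE Ud q20 WE V1 V2 r1 r2 abE abuE.
set h := (z.2 - z.1) * (lam.2 - lam.1) in Hc.
set h0 := (z.2 - z.1) * (b - lam.2 * m.1%:R) in Hc.
have range i : (al <= i <= be)%N -> [/\ i <= n.2, i <= m.2 & m.2 - i <= n.1]%N.
  by rewrite /al /be /alpha /beta => ib; split; lia.
have ab : (al <= be)%N by rewrite /al /be /alpha /beta; lia.
have bn : (be <= n.2)%N by rewrite geq_minr.
have bm : (be <= m.2)%N by rewrite geq_minl.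
have al0 : (al = 0 \/ al + m.1 = n.2)%N by rewrite /al /alpha; lia.
have Rc i : (al <= i <= be)%N -> tridiag n.2 m h c i = h0 * c i.
  by case/range => i2 _ _; apply: Hc.
have Rd i : (al <= i <= be)%N -> tridiag n.2 m h (fun i => d (m.2 - i)%N) i = h0 * d (m.2 - i)%N.
  case/range => i2 im in1.
  apply: (tridiag_reverse (h1 := (z.2 - z.1) * (b - lam.1 * m.1%:R))) => //; last by rewrite /h0 /h; ring.
  have -> : - h = (z.2 - z.1) * (lam.1 - lam.2) by rewrite /h; ring.
  exact: Hd.
have Re i : (al <= i <= be)%N -> tridiag n.2 m h e i = h0 * e i.
  case/range => i2 im in1.
  apply: (tridiag_dual (h1 := (lam.2 - lam.1) * (b' - z.2 * n.1%:R))) => //.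
    have -> : h = (lam.2 - lam.1) * (z.2 - z.1) by rewrite /h mulrC.
    exact: He.
  have n1E := natr_complement R[i] nm.
  have aE : a = lam.2 * (m.1 + m.2)%:R - (lam.2 - lam.1) * n.2%:R - b by rewrite -abE addrK.
  have auE : a' = z.2 * (n.1 + n.2)%:R - (z.2 - z.1) * m.2%:R - b' by rewrite -abuE addrK.
  move: link; rewrite aE auE !natrD n1E /h0 /h => /eqP.
  rewrite -subr_eq0 => /eqP L; apply/eqP; rewrite -subr_eq0; apply/eqP.
  by rewrite -[RHS]L; ring.
have w2E : w2 = \sum_(al <= i < be.+1) d (m.2 - i)%N *: wvec m.1 m.2 n.1 (m.2 - i).
  exact: sum_reverse.
have Wv (x : nat -> R[i]) : weyl n m (\sum_(al <= i < be.+1) x i *: wvec m.1 m.2 n.2 i) =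
    \sum_(al <= i < be.+1) x i *: wvec m.1 m.2 n.1 (m.2 - i) :> 'M[R[i]]_(_, _).
  rewrite /weyl basis_map_sum; apply: eq_big_nat => i ib; congr (_ *: _).
  exact: weyl_wvec.
have Dw : duality n m w3 = \sum_(al <= i < be.+1) e i *: wvec m.1 m.2 n.2 i.
  rewrite /duality basis_map_sum; apply: eq_big_nat => i ib; congr (_ *: _).
  exact: dualityE.
have [s [t [st Hcd]]] := tridiag_eigen_unique ab bn bm al0 Rc Rd.
have [s' [t' [st' Hec]]] := tridiag_eigen_unique ab bn bm al0 Re Rc.
have [s'' [t'' [st'' Hed]]] := tridiag_eigen_unique ab bn bm al0 Re Rd.
split.
- by rewrite w2E Wv; apply: dependent_sums st Hcd.
- by rewrite Dw; apply: dependent_sums st' Hec.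
- by rewrite Dw Wv w2E; apply: dependent_sums st'' Hed.
Qed.
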